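(* Let $p>0$ be a real number and let $K\subset\mathbb{R}^n$ be a convex body containing the origin in its interior. Then $$\inf_{h}\left\{\left(\int_{S^{n-1}}h^n(u)\,d\mathcal{H}^{n-1}(u)\right)^{\frac{p}{n+p}}\left(\int_{S^{n-1}}h^{-p}(u)h_K^{1-p}(u)\,dS_K(u)\right)^{\frac{n}{n+p}}\right\}$$ $$=\inf_{g}\left\{\left(\int_{\partial K}g^{-n}(x)\,dC_0(K,x)\right)^{\frac{p}{n+p}}\left(\int_{\partial K}g^p(x)(h_K(\nu_K(x)))^{1-p}\,dC_{n-1}(K,x)\right)^{\frac{n}{n+p}}\right\},$$ where the infimums are taken over all positive continuous functions $h:S^{n-1}\rightarrow \mathbb{R}$ and $g:\partial K\rightarrow \mathbb{R}$, respectively.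
   Context: A convex body in $\mathbb{R}^n$ is a compact convex set with non-empty interior; $\partial K$ is its boundary, $\mathcal{H}^{n-1}$ is $(n-1)$-dimensional Hausdorff measure, and $h_K(x)=\max\{\langle x,y\rangle:y\in K\}$ is the support function. A unit vector $u$ is an outer unit normal of $K$ at $x\in\partial K$ if $\langle x,u\rangle=h_K(u)$. For $\beta\subset\partial K$, $\nu(K,\beta)\subset S^{n-1}$ is the set of all outer unit normals of $K$ at points of $\beta$; for $\omega\subset S^{n-1}$, $\tau(K,\omega)$ is the set of all boundary points of $K$ having an outer unit normal in $\omega$. The Gauss map $\nu_K$ sends a regular boundary point (one with exactly one outer unit normal) to its outer unit normal; it is defined $\mathcal{H}^{n-1}$-almost everywhere on $\partial K$. The surface area measure is the Borel measure on $S^{n-1}$ given by $S_K(\omega)=\mathcal{H}^{n-1}(\tau(K,\omega))$. The curvature measures $C_0(K,\cdot)$ and $C_{n-1}(K,\cdot)$ are the finite Borel measures on $\partial K$ given by $C_0(K,\beta)=\mathcal{H}^{n-1}(\nu(K,\beta))$ and $C_{n-1}(K,\beta)=\mathcal{H}^{n-1}(\beta)$. *)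

(* Defs.v *)
From HB Require Import structures.
From mathcomp Require Import all_boot all_order all_algebra.
From mathcomp Require Import all_classical all_reals all_analysis.
Import Order.TTheory GRing.Theory Num.Theory.
Import numFieldNormedType.Exports.

Set Implicit Arguments.
Unset Strict Implicit.
Unset Printing Implicit Defensive.

Local Open Scope classical_set_scope.
Local Open Scope ring_scope.

(* R^n is 'rV[R]_n. The library norm `|x| on it is the sup norm, so the
   Euclidean norm, used for the sphere and for diameters, is defined here; the
   two norms induce the same topology. *)
Definition inner (R : realType) (n : nat) (x y : 'rV[R]_n) : R :=
  \sum_(i < n) x ord0 i * y ord0 i.

Definition enorm (R : realType) (n : nat) (x : 'rV[R]_n) : R :=
  Num.sqrt (inner x x).

Definition sphere (R : realType) (n : nat) : set 'rV[R]_n :=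
  [set u | enorm u = 1].
Arguments sphere : clear implicits.

(* R^n with its Borel sigma-algebra. Measures on the closed sets S^(n-1) and
   bd K are represented by set functions on R^n, integrated over these sets. *)
Notation borelRn R n := (g_sigma_algebraType (@open 'rV[R]_n)).

(* Volume of the unit ball of R^s, pi^(s/2) / Gamma(s/2 + 1), by the recurrence
   omega_(s+2) = (2 pi / (s+2)) omega_s. *)
Fixpoint ball_volume (R : realType) (s : nat) : R :=
  match s with
  | 0 => 1
  | 1 => 2
  | s'.+2 => 2 * pi / s'.+2%:R * ball_volume R s'
  end.

(* Equal to -oo when A is empty. *)
Definition ediam (R : realType) (n : nat) (A : set 'rV[R]_n) : \bar R :=
  ereal_sup [set (enorm (x - y))%:E | x in A & y in A].

(* The empty set is singled out so that it has weight 0 also for s = 0, where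
   every nonempty set has weight 1. *)
Definition hausdorff_weight (R : realType) (n s : nat) (A : set 'rV[R]_n) :
    \bar R :=
  if A == set0 then 0%E
  else ((ball_volume R s / 2 ^+ s)%:E * ediam A ^+ s)%E.

Definition hausdorff_content (R : realType) (n s : nat) (delta : R)
    (A : set 'rV[R]_n) : \bar R :=
  ereal_inf [set (\sum_(0 <= k <oo) hausdorff_weight s (B k))%E |
    B in [set B : nat -> set 'rV[R]_n |
           A `<=` \bigcup_k B k /\ forall k, (ediam (B k) <= delta%:E)%E]].

(* Hausdorff (outer) measure H^s, normalized to agree with Lebesgue measure on
   s-dimensional subspaces; the supremum is the limit as delta tends to 0. *)
Definition hausdorff (R : realType) (n s : nat) (A : set (borelRn R n)) :
    \bar R :=
  ereal_sup [set hausdorff_content s delta A | delta in [set d : R | 0 < d]].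

Definition convex_body (R : realType) (n : nat) (K : set 'rV[R]_n) : Prop :=
  [/\ compact K, convex_set (K : set (convex_lmodType 'rV[R]_n))
    & interior K !=set0].

Definition bd (R : realType) (n : nat) (K : set 'rV[R]_n) : set 'rV[R]_n :=
  closure K `\` interior K.

Definition support_fun (R : realType) (n : nat) (K : set 'rV[R]_n)
    (x : 'rV[R]_n) : R :=
  sup [set inner x y | y in K].

Definition outer_normal (R : realType) (n : nat) (K : set 'rV[R]_n)
    (x u : 'rV[R]_n) : Prop :=
  [/\ bd K x, sphere R n u & inner x u = support_fun K u].

(* nu(K, beta) *)
Definition normals_at (R : realType) (n : nat) (K beta : set 'rV[R]_n) :
    set 'rV[R]_n :=
  [set u | exists2 x, beta x & outer_normal K x u].

(* tau(K, omega) *)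
Definition points_with_normal (R : realType) (n : nat)
    (K omega : set 'rV[R]_n) : set 'rV[R]_n :=
  [set x | exists2 u, omega u & outer_normal K x u].

(* Away from the regular boundary points, where the Gauss map is undefined,
   this takes the default value 0. *)
Definition gauss_map (R : realType) (n : nat) (K : set 'rV[R]_n)
    (x : 'rV[R]_n) : 'rV[R]_n :=
  xget 0 [set u | outer_normal K x = [set u]].

(* Like hausdorff, the next three are set functions on all subsets of R^n; the
   integral evaluates them at Borel sets only, on which they are measures. *)
Definition surface_area_measure (R : realType) (n : nat) (K : set 'rV[R]_n)
    (omega : set (borelRn R n)) : \bar R :=
  hausdorff n.-1 (points_with_normal K omega).

(* C_0(K, .) *)
Definition curvature_measure0 (R : realType) (n : nat) (K : set 'rV[R]_n)
    (beta : set (borelRn R n)) : \bar R :=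
  hausdorff n.-1 (normals_at K beta).

(* C_(n-1)(K, .) *)
Definition curvature_measure_top (R : realType) (n : nat) (K : set 'rV[R]_n)
    (beta : set (borelRn R n)) : \bar R :=
  hausdorff n.-1 (bd K `&` beta).

(* A function on D is represented by a function on R^n, of which only the
   restriction to D matters. *)
Definition pos_continuous_on (R : realType) (n : nat) (D : set 'rV[R]_n) :
    set ('rV[R]_n -> R) :=
  [set f : 'rV[R]_n -> R | {within D, continuous f} /\ forall x, D x -> 0 < f x].

(* Main.v *)
Require Import Defs.
From HB Require Import structures.
From mathcomp Require Import all_boot all_order all_algebra.
From mathcomp Require Import all_classical all_reals all_analysis.
From mathcomp Require Import measurable_realfun lra ring.
Import Order.TTheory GRing.Theory Num.Theory.
Import numFieldNormedType.Exports.

Set Implicit Arguments.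
Unset Strict Implicit.
Unset Printing Implicit Defensive.
Local Open Scope classical_set_scope.
Local Open Scope ring_scope.

(** Relate x in bd K to u in the sphere when u is an outer normal of K at x.
    This relation is compact, and every point and every direction has a
    partner (exists_normal, exists_contact). It is moreover one-to-one up to
    sets of (n-1)-dimensional measure zero on both sides
    (singular_points_null, singular_normals_null). This is the Anderson-Klee
    argument: if x has two normals, then the nearest point projection onto K
    sends a piece of a 2-plane to x; such a piece meets one of countably many
    coordinate planes of codimension 2, and the projection, being
    nonexpansive, sends these planes to null sets. For a direction normal at
    two points the direction from the nearest point replaces the nearest
    point.

    Consequently the surface area measure is the image of the Hausdorff
    measure H of bd K under the Gauss map nu, and C_0 is the image of H on the
    sphere under the almost everywhere defined map tau from a direction to its
    contact point (integral_preimage_measure). All four integrals become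
    integrals against H, and if g could be chosen as 1/h o nu, the two
    products would agree.

    As nu is not continuous, replace 1/h o nu by the largest value of 1/h over
    all the normals at x. This function is upper semicontinuous, hence the
    limit of a decreasing sequence of continuous functions g (envelope). For
    each of them the integral of g^-n against C_0 is at most the integral of
    h^n, because g (tau u) >= 1 / h u, and the integral of g^p tends to that
    of h^-p, because g tends to 1/h o nu at regular points. Hence the second
    infimum is at most the first (boundary_competitor). The relation is
    symmetric, and exchanging points and directions gives the converse
    (sphere_competitor).

    Comparing integrals up to a factor c > 1 (integral_limit_ratio) makes the
    passage to the limit uniform: a bounded sequence of integrands converging
    to a limit bounded below either has a limit of infinite integral, in which
    case there is nothing to prove, or lives on a set of finite measure, where
    convergence is dominated.

    For these computations H has to be a measure on Borel sets, which follows
    from Caratheodory's criterion for metric outer measures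
    (closed_caratheodory). *)

(** * Hausdorff measure as a Borel measure *)

Section hausdorff_outer.
Variables (R : realType) (n : nat).
Local Notation E := 'rV[R]_n.
Implicit Types (A B : set E) (s : nat) (d : R).
Local Open Scope ereal_scope.

Lemma ball_volume_ge0 s : (0 <= ball_volume R s)%R.
Proof.
elim/ltn_ind: s => -[|[|s]] IH //=.
by rewrite mulr_ge0 ?IH// divr_ge0 ?ler0n ?mulr_ge0 ?pi_ge0.
Qed.

Lemma inner_ge0 (x : E) : (0 <= inner x x)%R.
Proof. by apply: sumr_ge0 => i _; rewrite -expr2 sqr_ge0. Qed.

Lemma enorm0 : enorm (0 : E) = 0%R.
Proof.
by rewrite /enorm /inner big1 ?sqrtr0// => i _; rewrite mxE mulr0.
Qed.

Lemma ediam_ge0 A : A !=set0 -> 0 <= ediam A.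
Proof.
move=> [x Ax]; apply: ereal_sup_ubound; exists x => //; exists x => //.
by rewrite subrr enorm0.
Qed.

Lemma ediam0 : ediam (set0 : set E) = -oo.
Proof.
rewrite /ediam [X in ereal_sup X](_ : _ = set0) ?ereal_sup0//.
by rewrite -subset0 => ? [].
Qed.

Lemma le_ediam A B : A `<=` B -> ediam A <= ediam B.
Proof.
move=> AB; apply: ereal_sup_le => _ [x Ax [y Ay <-]].
by exists x; [exact: AB|exists y; [exact: AB|]].
Qed.

Lemma weight0 s : hausdorff_weight s (set0 : set E) = 0.
Proof. by rewrite /hausdorff_weight eqxx. Qed.

Lemma weight_ge0 s A : 0 <= hausdorff_weight s A.
Proof.
rewrite /hausdorff_weight; case: ifPn => // /set0P A0.
by rewrite mule_ge0 ?expe_ge0 ?ediam_ge0// lee_fin divr_ge0 ?ball_volume_ge0.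
Qed.

Lemma le_weight s A B : A `<=` B ->
  hausdorff_weight s A <= hausdorff_weight s B.
Proof.
move=> AB; have [->|/set0P A0] := eqVneq A set0.
  by rewrite weight0 weight_ge0.
have B0 : B !=set0 by case: A0 => x /AB; exists x.
rewrite /hausdorff_weight !ifN; [|exact/set0P|exact/set0P].
rewrite lee_wpmul2l ?lee_fin ?divr_ge0 ?ball_volume_ge0//.
elim: s => [|s IH]; first by rewrite !expe0.
by rewrite !expeS lee_pmul ?ediam_ge0 ?expe_ge0 ?le_ediam ?ediam_ge0.
Qed.

(** Sets of diameter larger than d get an infinite weight, so that the covers
    by sets of diameter at most d are exactly the covers that matter. *)
Definition capped_weight s d A : \bar R :=
  if ediam A <= d%:E then hausdorff_weight s A else +oo.

Lemma capped_weight_ge0 s d A : 0 <= capped_weight s d A.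
Proof. by rewrite /capped_weight; case: ifP => // _; exact: weight_ge0. Qed.

Lemma capped_weight0 s d : capped_weight s d set0 = 0.
Proof. by rewrite /capped_weight ediam0 leNye weight0. Qed.

(** Seeing the content as the outer extension of a weight defined on all
    subsets gives its countable subadditivity. *)
Lemma hausdorff_contentE s d :
  hausdorff_content s d =
  mu_ext (capped_weight s d : set (g_sigma_algebraType [set: set E]) -> \bar R).
Proof.
apply/funext => A; apply/eqP; rewrite eq_le; apply/andP; split.
- apply: le_ereal_inf_tmp => _ [B [_ AB] <-].
  have [Bd|/existsNP[k Bk]] := pselect (forall k, ediam (B k : set E) <= d%:E).
    apply: ereal_inf_lbound; exists B => //.
    by apply: eq_eseriesr => k _; rewrite /capped_weight Bd.
  rewrite (@eseries_pinfty _ _ _ k) ?leey//.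
    by move=> i _; rewrite gt_eqF// (lt_le_trans _ (capped_weight_ge0 _ _ _)).
  by rewrite /capped_weight ifN//; apply/negP.
- apply: le_ereal_inf_tmp => _ [B [AB Bd] <-].
  apply: ereal_inf_lbound; exists B.
    by split => // k; exact: sub_sigma_algebra.
  by apply: eq_eseriesr => k _; rewrite /capped_weight Bd.
Qed.

Lemma content_ge0 s d A : 0 <= hausdorff_content s d A.
Proof.
by rewrite hausdorff_contentE; apply: mu_ext_ge0; exact: capped_weight_ge0.
Qed.

Lemma content_le_hausdorff s d A : (0 < d)%R ->
  hausdorff_content s d A <= hausdorff s A.
Proof. by move=> d0; apply: ereal_sup_ubound; exists d. Qed.

Lemma hausdorff_ge0 s A : 0 <= hausdorff s A.
Proof.
exact: le_trans (content_ge0 s 1 A) (content_le_hausdorff _ _ ltr01).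
Qed.

Lemma hausdorff0 s : hausdorff s (set0 : set E) = 0.
Proof.
apply/eqP; rewrite eq_le hausdorff_ge0 andbT.
apply: ge_ereal_sup => _ [d d0 <-]; rewrite hausdorff_contentE mu_ext0//.
- exact: capped_weight0.
- exact: capped_weight_ge0.
Qed.

Lemma le_hausdorff s : {homo @hausdorff R n s : A B / A `<=` B >-> A <= B}.
Proof.
move=> A B AB; apply: ge_ereal_sup => _ [d d0 <-].
apply: le_trans (content_le_hausdorff _ _ d0).
by rewrite hausdorff_contentE; exact: le_mu_ext.
Qed.

Lemma hausdorff_sigma_subadditive s : sigma_subadditive (@hausdorff R n s).
Proof.
move=> F; apply: ge_ereal_sup => _ [d d0 <-].
rewrite hausdorff_contentE.
have /le_trans := @mu_ext_sigma_subadditive _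
  (g_sigma_algebraType [set: set E]) _ _ (@capped_weight_ge0 s d) F.
apply.
apply: lee_nneseries => k _ *.
  by apply: mu_ext_ge0; exact: capped_weight_ge0.
by rewrite -hausdorff_contentE content_le_hausdorff.
Qed.

HB.instance Definition _ s := isOuterMeasure.Build R E (@hausdorff R n s)
  (hausdorff0 s) (hausdorff_ge0 s) (le_hausdorff s)
  (@hausdorff_sigma_subadditive s).

End hausdorff_outer.

Section metric_outer_measure.
Variables (R : realType) (V : normedModType R).
Variable mu : {outer_measure set V -> \bar R}.
Local Open Scope ereal_scope.

Definition metric_additive := forall (e : R) (A B : set V), (0 < e)%R ->
  (forall x y, A x -> B y -> (e <= `|x - y|)%R) -> mu A + mu B <= mu (A `|` B).

Hypothesis mu_metric : metric_additive.

(** Caratheodory's criterion. Cut the part A of X outside F according to the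
    distance to F: far k is at distance at least 1/(k+1), hence additive with
    F. The shells D k of every other index are at positive distance from each
    other, so that the measures of all shells have a finite sum; what A loses
    by passing to far k is controlled by the tail of this sum. *)
Lemma closed_caratheodory (F : set V) : closed F -> mu.-caratheodory F.
Proof.
move=> clF; apply: le_caratheodory_measurable => X.
have [->|Xoo] := eqVneq (mu X) +oo; first exact: leey.
have Xfin : mu X \is a fin_num.
  by rewrite ge0_fin_numE ?outer_measure_ge0// lt_neqAle Xoo leey.
pose A := X `&` ~` F.
pose far k := A `&` [set x : V | forall y, F y -> (k.+1%:R^-1 <= `|x - y|)%R].
pose D k := far k.+2 `\` far k.+1.
have le_far k l : (k <= l)%N -> far k `<=` far l.
  move=> kl x [Ax fx]; split => // y /fx; apply: le_trans.
  by rewrite lef_pV2 ?posrE ?ltr0n// ler_nat ltnS.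
have farX k : far k `<=` X by move=> x [[]].
have far_sep k : mu (X `&` F) + mu (far k) <= mu X.
  apply: (le_trans (@mu_metric k.+1%:R^-1%R _ _ _ _)).
  - by rewrite invr_gt0 ltr0n.
  - by move=> x y [_ Fx] [_ /(_ _ Fx)]; rewrite distrC.
  - by apply: le_outer_measure => x [[]//|]; exact: farX.
have shell k : mu (far k) + mu (D k) <= mu (far k.+2).
  apply: (le_trans (@mu_metric (k.+1%:R^-1 - k.+2%:R^-1)%R _ _ _ _)).
  - by rewrite subr_gt0 ltf_pV2 ?posrE ?ltr0n// ltr_nat.
  - move=> x y [_ fx] [[Ay _] /not_andP[//|/existsNP[z /not_implyP[Fz /negP]]]].
    rewrite -ltNge => yz; rewrite lerBlDr (le_trans (fx _ Fz))//.
    by rewrite (le_trans (ler_distD y _ _))// lerD2l ltW.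
  - by apply: le_outer_measure => x [|[]//]; apply: le_far; rewrite leqW.
(* Each shell is separated from the far set two indices below, so the sum
   telescopes two steps at a time. *)
have partial m : \sum_(0 <= i < m) mu (D i) <= mu (far m) + mu (far m.+1).
  elim: m => [|m IH].
    by rewrite big_nil adde_ge0// outer_measure_ge0.
  rewrite big_nat_recr//=.
  apply: (le_trans (leeD IH (lexx _))).
  by rewrite addeAC addeC leeD2l.
have sumD : \sum_(0 <= i <oo) mu (D i) < +oo.
  apply: (@le_lt_trans _ _ (mu X + mu X)).
    apply: lime_le.
      by apply: is_cvg_nneseries => *; exact: outer_measure_ge0.
    apply: nearW => m; apply: (le_trans (partial m)).
    by apply: leeD; apply: le_outer_measure.
  by rewrite -ge0_fin_numE ?fin_numD ?Xfin// adde_ge0 ?outer_measure_ge0.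
have tail0 := @nneseries_tail_cvg _ _ xpredT sumD
  (fun i _ => outer_measure_ge0 mu (D i)).
have coverA k : A `<=` far k.+1 `|` \bigcup_(i in ~` `I_k) D i.
  move=> x Ax; have [|fx] := pselect (far k.+1 x); [by left|right].
  have [m fm] : exists m, far m x.
    have /nbhs_ballP[e /= e0 xe] : nbhs x (~` F).
      by apply: open_nbhs_nbhs; split; [exact: closed_openC|case: Ax].
    exists (Num.truncn e^-1); split => // y Fy; rewrite leNgt; apply/negP => xy.
    apply: (xe y) => //; rewrite -ball_normE/=; apply: (lt_trans xy).
    by rewrite invf_plt ?posrE ?ltr0n// -truncn_lt_nat// invr_ge0 ltW.
  pose P m := `[< far m x >].
  have exP : exists m, P m by exists m; apply/asboolP.
  case: (ex_minnP exP) => l /asboolP fl lmin.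
  have kl : (k.+1 < l)%N.
    by rewrite ltnNge; apply/negP => lk; apply: fx; exact: le_far fl.
  case: l kl fl lmin => [//|[//|l]] kl fl lmin.
  exists l; first by move: kl; rewrite /= !ltnS leqNgt => /negP.
  split => // fl1; have := lmin l.+1; rewrite ltnn => H.
  by have : false by apply: H; apply/asboolP.
have bound k : mu (X `&` F) + mu A <= mu X + \sum_(k <= i <oo) mu (D i).
  have : mu A <= mu (far k.+1) + \sum_(k <= i <oo) mu (D i).
    apply: (le_trans (le_outer_measure mu _ _ (coverA k))).
    apply: (le_trans (outer_measureU2 _ _ _)).
    by rewrite leeD2l// outer_measure_sigma_subadditive_tail.
  move=> /(leeD2l (mu (X `&` F)))/le_trans; apply.
  by rewrite addeA leeD2r.
have lim : (fun k => mu X + \sum_(k <= i <oo) mu (D i)) @ \oo --> mu X.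
  rewrite -[X in _ --> X]adde0; apply: cvgeD => //; last exact: cvg_cst.
  by rewrite fin_num_adde_defr.
rewrite -(cvg_lim _ lim)//; apply: lime_ge.
  by apply/cvg_ex; exists (mu X).
exact: nearW.
Qed.

Lemma borel_caratheodory (A : set V) :
  <<s [set U : set V | open U] >> A -> mu.-caratheodory A.
Proof.
apply: smallest_sub; last first.
  move=> U /= oU; rewrite -[U]setCK; apply: caratheodory_measurable_setC.
  by apply: closed_caratheodory; exact: open_closedC.
split.
- exact: caratheodory_measurable_set0.
- by move=> B mB; rewrite setTD; exact: caratheodory_measurable_setC.
- exact: caratheodory_measurable_bigcup.
Qed.

Lemma metric_sigma_additive :
  semi_sigma_additive (mu : set (g_sigma_algebraType (@open V)) -> \bar R).
Proof.
move=> A mA tA mbA.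
have cA i : mu.-caratheodory (A i) by exact: (borel_caratheodory (mA i)).
have cbA : mu.-caratheodory (\bigcup_i A i) by exact: (borel_caratheodory mbA).
exact: (@caratheodory_measure_sigma_additive R V mu A).
Qed.

End metric_outer_measure.

Section hausdorff_measure.
Variables (R : realType) (n : nat).
Local Notation E := 'rV[R]_n.

(** The separation in the metric criterion is measured by the sup norm, the
    diameters by the Euclidean norm. *)
Lemma norm_le_enorm (x : E) : `|x| <= enorm x.
Proof.
rewrite {1}/Num.Def.normr/= mx_normrE; apply/bigmax_leP; split.
  exact: sqrtr_ge0.
move=> [i j] _ /=; rewrite -sqrtr_sqr; apply: ler_wsqrtr.
rewrite /inner (bigD1 j)//= (ord1 i) expr2 lerDl sumr_ge0// => k _.
by rewrite -expr2 sqr_ge0.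
Qed.

Lemma ediam_separated (C A B : set E) (d e : R) : d < e ->
  (ediam C <= d%:E)%E ->
  (forall x y, A x -> B y -> e <= `|x - y|) ->
  C `&` A = set0 \/ C `&` B = set0.
Proof.
move=> de Cd AB; apply: contrapT.
move=> /not_orP[/eqP/set0P[x [Cx Ax]] /eqP/set0P[y [Cy By]]].
have : ((enorm (x - y))%:E <= d%:E)%E.
  by apply: le_trans Cd; apply: ereal_sup_ubound; exists x => //; exists y.
rewrite lee_fin => xyd.
have := AB _ _ Ax By; have := norm_le_enorm (x - y); lra.
Qed.

Local Open Scope ereal_scope.

(** A set of diameter less than e meets at most one of two sets at distance e,
    so a fine cover of the union splits into covers of the two parts. *)
Lemma content_separated s (A B : set E) (d e : R) : (d < e)%R ->
  (forall x y, A x -> B y -> (e <= `|x - y|)%R) ->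
  hausdorff_content s d A + hausdorff_content s d B <=
  hausdorff_content s d (A `|` B).
Proof.
move=> de AB; apply: le_ereal_inf_tmp => _ [C [ABC Cd] <-].
have trace (D : set E) : D `<=` \bigcup_k C k ->
    hausdorff_content s d D <=
    \sum_(k <oo) hausdorff_weight s (C k `&` D : set E).
  move=> DC; apply: ereal_inf_lbound; exists (fun k => C k `&` D) => //; split.
    by move=> x Dx; have [k _ Ckx] := DC x Dx; exists k.
  by move=> k; apply: le_trans (Cd k); apply: le_ediam => x [].
apply: (@le_trans _ _ (\sum_(k <oo) hausdorff_weight s (C k `&` A : set E) +
                       \sum_(k <oo) hausdorff_weight s (C k `&` B : set E))).
  by apply: leeD; apply: trace; apply: subset_trans ABC; [left|right].
rewrite -nneseriesD; [|by move=> *; exact: weight_ge0..].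
apply: lee_nneseries => [k _ _|k _].
  by rewrite adde_ge0// weight_ge0.
by have [->|->] := ediam_separated de (Cd k) AB; rewrite weight0 ?add0e ?adde0;
  apply: le_weight.
Qed.

Lemma le_content s (A : set E) (d1 d2 : R) : (d1 <= d2)%R ->
  hausdorff_content s d2 A <= hausdorff_content s d1 A.
Proof.
move=> d12; apply: ereal_inf_le_tmp => _ [B [AB Bd] <-].
exists B => //; split => //.
by move=> k; apply: le_trans (Bd k) _; rewrite lee_fin.
Qed.

Lemma hausdorff_metric s : metric_additive (@hausdorff R n s).
Proof.
move=> e A B e0 AB /=.
have hc := @content_le_hausdorff R n s.
have hoo (C : set E) : hausdorff s C != -oo.
  by rewrite gt_eqF// (lt_le_trans _ (hausdorff_ge0 _ _)).
have key d1 d2 : (0 < d1)%R -> (0 < d2)%R ->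
    hausdorff_content s d1 A + hausdorff_content s d2 B <=
    hausdorff s (A `|` B).
  move=> d10 d20; pose d := Num.min (Num.min d1 d2) (e / 2)%R.
  have d0 : (0 < d)%R by rewrite !lt_min d10 d20 divr_gt0.
  apply: le_trans (hc _ _ d0).
  apply: le_trans (@content_separated s A B d e _ AB); last first.
    by rewrite gt_min; apply/orP; right; lra.
  by apply: leeD; apply: le_content; rewrite !ge_min lexx ?orbT.
have [->|ABoo] := eqVneq (hausdorff s (A `|` B)) +oo; first exact: leey.
have fin (C : set E) : C `<=` A `|` B -> hausdorff s C \is a fin_num.
  move=> CAB; rewrite ge0_fin_numE ?hausdorff_ge0//.
  by apply: le_lt_trans (le_hausdorff s CAB) _; rewrite lt_neqAle ABoo leey.
have cfin d (C : set E) : (0 < d)%R -> C `<=` A `|` B ->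
    hausdorff_content s d C \is a fin_num.
  move=> d0 /fin; rewrite !ge0_fin_numE ?hausdorff_ge0 ?content_ge0//.
  exact: le_lt_trans (hc _ _ d0).
have [sA sB] : A `<=` A `|` B /\ B `<=` A `|` B by split; [left|right].
rewrite -leeBrDr ?fin//; apply: ge_ereal_sup => _ [d1 d10 <-].
rewrite leeBrDr ?fin// addeC -leeBrDr ?cfin//.
apply: ge_ereal_sup => _ [d2 d20 <-].
by rewrite leeBrDr ?cfin// addeC key.
Qed.

Lemma hausdorff_sigma_additive s :
  semi_sigma_additive (@hausdorff R n s : set (borelRn R n) -> \bar R).
Proof. exact: metric_sigma_additive (@hausdorff_metric s). Qed.

HB.instance Definition _ s := isMeasure.Build _ (borelRn R n) R
  (@hausdorff R n s : set (borelRn R n) -> \bar R)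
  (@hausdorff0 R n s) (@hausdorff_ge0 R n s) (@hausdorff_sigma_additive s).

End hausdorff_measure.

(** * Null sets of dimension n - 1 *)

Section hausdorff_null.
Variables (R : realType) (n : nat).
Local Notation E := 'rV[R]_n.

Lemma outer_measure_bigcup0 (T : Type) (mu : {outer_measure set T -> \bar R})
    (F : (set T)^nat) : (forall i, mu (F i) = 0%E) -> mu (\bigcup_i F i) = 0%E.
Proof.
move=> F0; apply/eqP; rewrite eq_le outer_measure_ge0 andbT.
apply: le_trans (outer_measure_sigma_subadditive mu F) _.
by rewrite eseries0.
Qed.

Lemma outer_measure_countable_bigcup0 (T : Type) (I : countType)
    (mu : {outer_measure set T -> \bar R}) (F : I -> set T) :
  (forall i, mu (F i) = 0%E) -> mu (\bigcup_i F i) = 0%E.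
Proof.
move=> F0.
pose G k := if unpickle k is Some i then F i else set0.
apply/eqP; rewrite eq_le outer_measure_ge0 andbT.
rewrite -[leRHS](@outer_measure_bigcup0 _ mu G).
  apply: le_outer_measure => x [i _ Fx]; exists (pickle i) => //.
  by rewrite /G pickleK.
by move=> k; rewrite /G; case: unpickle => // *; rewrite outer_measure0.
Qed.

Lemma hausdorff_content_le_sum (s m : nat) (d : R) (A : set E)
    (B : nat -> set E) :
  A `<=` \bigcup_(k in `I_m) B k ->
  (forall k, ediam (B k) <= d%:E)%E ->
  (hausdorff_content s d A <= \sum_(k < m) hausdorff_weight s (B k))%E.
Proof.
move=> AB Bd; pose F k := if (k < m)%N then B k else set0.
apply: ereal_inf_lbound; exists F.
  split => [x /AB[k /= km Bx]|k]; first by exists k => //; rewrite /F km.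
  by rewrite /F; case: ifP; rewrite // ediam0 leNye.
rewrite (nneseries_split _ m); last by move=> k _; exact: weight_ge0.
rewrite [X in (_ + X)%E]eseries0 ?adde0; last first.
  by move=> k mk _; rewrite /F ltnNge mk/= weight0.
by rewrite add0n big_mkord; apply: eq_bigr => k _; rewrite /F ltn_ord.
Qed.

Lemma weight_le s (A : set E) (d : R) : 0 <= d -> (ediam A <= d%:E)%E ->
  (hausdorff_weight s A <= (ball_volume R s / 2 ^+ s * d ^+ s)%:E)%E.
Proof.
move=> d0 Ad; have c0 : 0 <= ball_volume R s / 2 ^+ s.
  by rewrite divr_ge0 ?ball_volume_ge0.
rewrite /hausdorff_weight; case: ifPn => [_|/set0P A0].
  by rewrite lee_fin mulr_ge0 ?exprn_ge0.
rewrite [leRHS]EFinM lee_wpmul2l ?lee_fin//.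
elim: s {c0} => [|s IH]; first by rewrite expe0 expr0.
by rewrite expeS exprS EFinM lee_pmul ?expe_ge0 ?ediam_ge0.
Qed.

(** A set that needs only O(N^s) pieces of diameter O(1/N) has dimension at
    most s: the pieces have total (s+1)-dimensional weight O(1/N). *)
Lemma hausdorff_null_cover (s : nat) (C1 C2 : R) (A : set E) : 0 <= C1 ->
  0 <= C2 ->
  (forall N, (0 < N)%N -> exists (m : nat) (B : nat -> set E),
    [/\ A `<=` \bigcup_(k in `I_m) B k, m%:R <= C1 * N%:R ^+ s &
        forall k, (ediam (B k) <= (C2 / N%:R)%:E)%E]) ->
  hausdorff s.+1 A = 0%E.
Proof.
move=> C10 C20 cov; apply/eqP; rewrite eq_le hausdorff_ge0 andbT.
apply: ge_ereal_sup => _ [d d0 <-].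
apply/lee_addgt0Pr => e e0; rewrite add0e.
pose c := ball_volume R s.+1 / 2 ^+ s.+1.
have c0 : 0 <= c by rewrite divr_ge0 ?ball_volume_ge0.
pose D := C1 * c * C2 ^+ s.+1.
have D0 : 0 <= D by apply: mulr_ge0; [exact: mulr_ge0|exact: exprn_ge0].
pose N := (Num.truncn (C2 / d + D / e)).+1.
have NN : C2 / d + D / e < N%:R.
  by rewrite -truncn_lt_nat// addr_ge0 ?divr_ge0// ltW.
have N0 : 0 < N%:R :> R by rewrite ltr0n.
have [m [B [AB mC Bd]]] := cov N isT.
have C2N : C2 / N%:R <= d.
  rewrite ler_pdivrMr// mulrC -ler_pdivrMr//; apply: le_trans (ltW NN).
  by rewrite lerDl divr_ge0// ltW.
have DN : D / N%:R <= e.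
  rewrite ler_pdivrMr// mulrC -ler_pdivrMr//; apply: le_trans (ltW NN).
  by rewrite lerDr divr_ge0// ltW.
apply: (le_trans (hausdorff_content_le_sum s.+1 AB _)) => [k|].
  by apply: le_trans (Bd k) _; rewrite lee_fin.
apply: (@le_trans _ _ (\sum_(k < m) (c * (C2 / N%:R) ^+ s.+1)%:E)%E).
  by apply: lee_sum => k _; rewrite weight_le// divr_ge0.
rewrite sumEFin lee_fin big_const_ord iter_addr_0 -[leLHS]mulr_natl.
apply: le_trans DN.
apply: (@le_trans _ _ (C1 * N%:R ^+ s * (c * (C2 / N%:R) ^+ s.+1))).
  by rewrite ler_wpM2r// mulr_ge0// exprn_ge0// divr_ge0.
rewrite le_eqVlt; apply/orP; left; apply/eqP.
rewrite /D expr_div_n [N%:R ^+ s.+1]exprS.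
have : N%:R ^+ s != 0 :> R by rewrite expf_neq0// gt_eqF.
move: (N%:R ^+ s) (C2 ^+ s.+1) (c : R) => P Q c' P0.
by field; rewrite P0 gt_eqF.
Qed.

Lemma coord_le_norm (x : E) i : `|x ord0 i| <= `|x|.
Proof.
rewrite [leRHS]/Num.Def.normr/= mx_normrE.
exact: (le_bigmax _ (fun k => `|x k.1 k.2|) (ord0, i)).
Qed.

Lemma enorm_le (w : E) (e : R) : 0 <= e -> (forall l, `|w ord0 l| <= e) ->
  enorm w <= n%:R * e.
Proof.
move=> e0 we; rewrite -(@ger0_norm _ (n%:R * e)) ?mulr_ge0// -sqrtr_sqr.
apply: ler_wsqrtr; apply: (@le_trans _ _ (n%:R * e ^+ 2)).
  rewrite mulr_natl -[n in leRHS]card_ord -sumr_const; apply: ler_sum => l _.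
  by rewrite -expr2 -real_normK ?num_real// ler_sqr ?nnegrE.
rewrite exprMn ler_wpM2r ?sqr_ge0//; case: (n) => [|k].
  by rewrite expr0n.
by rewrite ler_eXnr// ler1n.
Qed.

(** The part of a plane of codimension 2 in a box of side 2M consists of at
    most (2MN+1)^(n-2) cells of side 1/N, and a nonexpansive correspondence T
    does not increase their diameters; so hausdorff_null_cover applies. *)
Lemma codim2_image_null (i j : 'I_n) (q r : R) (T : E -> E -> Prop) : i != j ->
  (forall a z a' z', T a z -> T a' z' -> enorm (a - a') <= enorm (z - z')) ->
  hausdorff n.-1
    [set a | exists2 z, T a z & z ord0 i = q /\ z ord0 j = r] = 0%E.
Proof.
move=> ij Tlip.
pose A (M : nat) := [set a | exists z,
  [/\ T a z, z ord0 i = q, z ord0 j = r & `|z| <= M%:R]].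
apply/eqP; rewrite eq_le hausdorff_ge0 andbT.
rewrite -[leRHS](@outer_measure_bigcup0 _ (@hausdorff R n n.-1) A).
  apply: le_hausdorff => a [z Taz [zi zj]].
  exists (Num.truncn `|z|).+1 => //; exists z; split => //.
  by apply/ltW; rewrite -truncn_lt_nat.
move=> M /=.
pose I := {l : 'I_n | (l != i) && (l != j)}.
have cI : (#|{: I}| = n.-2)%N.
  have := cardC (pred2 i j); rewrite card2 ij card_ord card_sig => nE.
  rewrite (eq_card (_ : _ =i predC (pred2 i j))) => [|l].
    by rewrite -(addKn 2 #|_|) nE subn2.
  by rewrite !inE negb_or.
have n2 : (1 < n)%N.
  by have := max_card (mem (pred2 i j)); rewrite card2 ij card_ord.
have -> : (n.-1 = n.-2.+1)%N by case: (n) n2 => [|[]].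
apply: (@hausdorff_null_cover _ ((2 * M + 1)%:R ^+ n.-2) n%:R).
- by rewrite exprn_ge0.
- by [].
move=> N N0.
pose J := {ffun I -> 'I_(2 * M * N).+1}.
(* the coordinates other than i and j, rounded down to multiples of 1/N *)
pose cell (z : E) : J :=
  [ffun l => inord (Num.truncn ((z ord0 (val l) + M%:R) * N%:R))].
pose B (k : nat) := [set a | exists z,
  [/\ T a z, z ord0 i = q, z ord0 j = r & `|z| <= M%:R] /\
  enum_rank (cell z) = k :> nat].
exists #|J|, B; split.
- by move=> a [z Tz]; exists (enum_rank (cell z)); [exact: ltn_ord|exists z].
- rewrite card_ffun card_ord cI natrX -exprMn lerXn2r ?nnegrE ?mulr_ge0//.
  rewrite -natrM ler_nat mulnDl mul1n -addn1 leq_add2l//.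
- move=> k; apply: ge_ereal_sup => _ [a [z [[Taz zi zj zM] zk]]]
    [a' [z' [[Taz' zi' zj' zM'] zk']] <-].
  rewrite lee_fin; apply: le_trans (Tlip _ _ _ _ Taz Taz') _.
  apply: enorm_le => [|l]; first by rewrite invr_ge0.
  rewrite !mxE.
  have [->|li] := eqVneq l i; first by rewrite zi zi' subrr normr0 invr_ge0.
  have [->|lj] := eqVneq l j; first by rewrite zj zj' subrr normr0 invr_ge0.
  have lij : (l != i) && (l != j) by rewrite li.
  have /ffunP/(_ (Sub l lij)) : cell z = cell z'.
    by apply: enum_rank_inj; apply: val_inj; rewrite /= zk zk'.
  rewrite !ffunE SubK.
  have coord (y : E) : `|y| <= M%:R -> [/\ 0 <= (y ord0 l + M%:R) * N%:R &
      (Num.truncn ((y ord0 l + M%:R) * N%:R) < (2 * M * N).+1)%N].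
    move=> yM; have := le_trans (coord_le_norm y l) yM.
    rewrite ler_norml => /andP[y1 y2].
    have y0 : 0 <= (y ord0 l + M%:R) * N%:R by rewrite mulr_ge0//; lra.
    split => //; rewrite truncn_lt_nat//.
    rewrite (@le_lt_trans _ _ (2 * M * N)%:R) ?ltr_nat//.
    by rewrite !natrM ler_wpM2r//; lra.
  have [p0 pb] := coord _ zM; have [p0' pb'] := coord _ zM'.
  move/(congr1 (@nat_of_ord _)); rewrite !inordK// => tt.
  have := truncn_itv p0; have := truncn_itv p0'; rewrite tt.
  set t := Num.truncn _ => /andP[h1 h2] /andP[h3 h4].
  have Np : 0 < N%:R :> R by rewrite ltr0n.
  rewrite -[leRHS]mul1r ler_pdivlMr// -[X in _ * X]gtr0_norm// -normrM.
  rewrite ler_norml; rewrite -natr1 in h2 h4.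
  by apply/andP; split; lra.
Qed.

End hausdorff_null.

(** * Inner product and thick fibres *)

Section inner_product.
Variables (R : realType) (n : nat).
Local Notation E := 'rV[R]_n.
Implicit Types (x y z u v : E).

Lemma innerC x y : inner x y = inner y x.
Proof. by apply: eq_bigr => i _; rewrite mulrC. Qed.

Lemma innerDl x y z : inner (x + y) z = inner x z + inner y z.
Proof. by rewrite -big_split; apply: eq_bigr => i _; rewrite mxE mulrDl. Qed.

Lemma innerZl (a : R) x z : inner (a *: x) z = a * inner x z.
Proof.
by rewrite /inner mulr_sumr; apply: eq_bigr => i _; rewrite mxE mulrA.
Qed.

Lemma innerNl x z : inner (- x) z = - inner x z.
Proof. by rewrite -scaleN1r innerZl mulN1r. Qed.

Lemma innerBl x y z : inner (x - y) z = inner x z - inner y z.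
Proof. by rewrite innerDl innerNl. Qed.

Lemma innerDr x y z : inner z (x + y) = inner z x + inner z y.
Proof. by rewrite innerC innerDl !(innerC z). Qed.

Lemma innerZr (a : R) x z : inner z (a *: x) = a * inner z x.
Proof. by rewrite innerC innerZl (innerC z). Qed.

Lemma innerNr x z : inner z (- x) = - inner z x.
Proof. by rewrite innerC innerNl (innerC z). Qed.

Lemma innerBr x y z : inner z (x - y) = inner z x - inner z y.
Proof. by rewrite innerDr innerNr. Qed.

Definition innerE := (innerBl, innerBr, innerDl, innerDr, innerZl, innerZr,
  innerNl, innerNr).

Lemma inner_eq0 x : inner x x = 0 -> x = 0.
Proof.
move=> /eqP; rewrite psumr_eq0 => [|i _]; last by rewrite -expr2 sqr_ge0.
move=> /allP x0; apply/rowP => i; rewrite mxE; apply/eqP.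
by have := x0 i (mem_index_enum i); rewrite mulf_eq0 orbb.
Qed.

Lemma inner_gt0 x : x != 0 -> 0 < inner x x.
Proof.
move=> x0; rewrite lt_neqAle inner_ge0 andbT eq_sym.
by apply: contra x0 => /eqP/inner_eq0 ->.
Qed.

Lemma enorm_ge0 x : 0 <= enorm x. Proof. exact: sqrtr_ge0. Qed.

Lemma sqr_enorm x : enorm x ^+ 2 = inner x x.
Proof. by rewrite sqr_sqrtr ?inner_ge0. Qed.

Lemma sphereE u : sphere R n u <-> inner u u = 1.
Proof.
split=> [u1|u1]; first by rewrite -sqr_enorm u1 expr1n.
by rewrite /sphere/= /enorm u1 sqrtr1.
Qed.

Lemma le_enorm x y : inner x x <= inner y y -> enorm x <= enorm y.
Proof. exact: ler_wsqrtr. Qed.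

(** By Lagrange's identity the Gram determinant of (d, e) is half the sum of
    the squares of its 2 x 2 minors. *)
Lemma independent_minor (d e : E) : inner d d * inner e e != inner d e ^+ 2 ->
  exists i j, d ord0 i * e ord0 j - d ord0 j * e ord0 i != 0.
Proof.
move=> de; apply: contrapT => /forallNP nij; move/eqP: de; apply.
rewrite expr2 /inner !mulr_suml; apply: eq_bigr => i _.
rewrite !mulr_sumr; apply: eq_bigr => j _.
have /forallNP/(_ j)/negP := nij i; rewrite negbK subr_eq0 => /eqP dij.
rewrite [LHS](_ : _ = d ord0 i * e ord0 j * (d ord0 i * e ord0 j)).
  by rewrite {1}dij; ring.
by ring.
Qed.

(** The span of d and e projects isomorphically onto some coordinate plane, so
    small multiples of d and e move two of the coordinates of z onto nearby
    rational values; Cramer's rule gives the multiples. *)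
Lemma rational_codim2 (z d e : E) (eps : R) : 0 < eps ->
  inner d d * inner e e != inner d e ^+ 2 ->
  exists (i j : 'I_n) (q r : rat) (a b : R),
    [/\ i != j, `|a| <= eps, `|b| <= eps,
      (z + a *: d + b *: e) ord0 i = ratr q &
      (z + a *: d + b *: e) ord0 j = ratr r].
Proof.
move=> eps0 /independent_minor[i [j D0]].
set D := _ - _ in D0.
have ij : i != j by apply: contra D0 => /eqP ij; rewrite /D ij subrr.
pose S := 1 + `|d ord0 i| + `|d ord0 j| + `|e ord0 i| + `|e ord0 j|.
have S0 : 0 < S by rewrite /S -!addrA ltr_wpDr// !addr_ge0.
pose eta := eps * `|D| / S.
have eta0 : 0 < eta by rewrite divr_gt0// mulr_gt0// normr_gt0.
have close (c : R) : exists q : rat, `|ratr q - c| <= eta.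
  have [|q] := @rat_in_itvoo _ (c - eta) (c + eta); first lra.
  rewrite in_itv/= => /andP[h1 h2]; exists q.
  by rewrite ler_norml; apply/andP; split; lra.
have [q hq] := close (z ord0 i); have [r hr] := close (z ord0 j).
pose s := ratr q - z ord0 i; pose t := ratr r - z ord0 j.
have small (x y : R) : `|x| + `|y| <= S -> `|(s * x - t * y) / D| <= eps.
  move=> xyS; rewrite normrM normfV ler_pdivrMr ?normr_gt0//.
  apply: (le_trans (ler_normB _ _)); rewrite !normrM.
  apply: (@le_trans _ _ (eta * (`|x| + `|y|))).
    by rewrite mulrDr lerD// ler_wpM2r.
  apply: (@le_trans _ _ (eta * S)); first by rewrite ler_wpM2l// ltW.
  by rewrite /eta divfK// gt_eqF.
exists i, j, q, r, ((s * e ord0 j - t * e ord0 i) / D),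
  ((s * (- d ord0 j) - t * (- d ord0 i)) / D); split => //.
- by apply: small; rewrite /S; have := normr_ge0 (d ord0 i);
    have := normr_ge0 (d ord0 j); lra.
- by apply: small; rewrite /S !normrN; have := normr_ge0 (e ord0 i);
    have := normr_ge0 (e ord0 j); lra.
- rewrite !mxE; have -> : ratr q = z ord0 i + s by rewrite /s; ring.
  by move: D0; rewrite /D => D0; field.
- rewrite !mxE; have -> : ratr r = z ord0 j + t by rewrite /t; ring.
  by move: D0; rewrite /D => D0; field.
Qed.

(** Let a nonexpansive correspondence T relate each a in A to a whole piece of
    a 2-plane. By rational_codim2 this piece meets one of countably many
    coordinate planes of codimension 2, so A lies in countably many null sets
    given by codim2_image_null. *)
Lemma thick_fibre_null (A : set E) (T : E -> E -> Prop) :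
  (forall a z a' z', T a z -> T a' z' -> enorm (a - a') <= enorm (z - z')) ->
  (forall a, A a -> exists z d e : E, exists2 eps : R, 0 < eps &
    inner d d * inner e e != inner d e ^+ 2 /\
    forall s t, `|s| <= eps -> `|t| <= eps -> T a (z + s *: d + t *: e)) ->
  hausdorff n.-1 A = 0%E.
Proof.
move=> Tlip TA.
pose F (k : 'I_n * 'I_n * rat * rat) := let: (i, j, q, r) := k in
  if i != j then [set a | exists2 z, T a z &
    z ord0 i = ratr q /\ z ord0 j = ratr r] else set0.
apply/eqP; rewrite eq_le hausdorff_ge0 andbT.
rewrite -[leRHS](@outer_measure_countable_bigcup0 _ _ _
  (@hausdorff R n n.-1) F).
  apply: le_hausdorff => a /TA[z [d [e [eps eps0 [de Ta]]]]].
  have [i [j [q [r [s [t [ij sE tE zi zj]]]]]]] := rational_codim2 z eps0 de.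
  exists (i, j, q, r) => //; rewrite /F ij; exists (z + s *: d + t *: e) => //.
  exact: Ta.
move=> [[[i j] q] r] /=; case: ifPn => [ij|_]; last exact: hausdorff0.
exact: codim2_image_null.
Qed.

Lemma continuous_sum (U : topologicalType) (I : Type) (r : seq I)
    (f : I -> U -> R) :
  (forall i, continuous (f i)) -> continuous (fun t => \sum_(i <- r) f i t).
Proof.
move=> fc; elim: r => [|i r IH] t.
  by under eq_fun do rewrite big_nil; exact: cvg_cst.
by under eq_fun do rewrite big_cons; apply: cvgD; [exact: fc|exact: IH].
Qed.

Lemma continuous_inner (U : topologicalType) (f g : U -> E) :
  continuous f -> continuous g -> continuous (fun t => inner (f t) (g t)).
Proof.
move=> fc gc; apply: continuous_sum => i t; apply: cvgM.
  exact: (@continuous_comp _ _ _ f (fun M : E => M ord0 i) t (fc t)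
    (@coord_continuous _ _ _ _ _ _)).
exact: (@continuous_comp _ _ _ g (fun M : E => M ord0 i) t (gc t)
    (@coord_continuous _ _ _ _ _ _)).
Qed.

Lemma enorm_le_norm x : enorm x <= n%:R * `|x|.
Proof. by apply: enorm_le => // i; exact: coord_le_norm. Qed.

Lemma inner_le_norm x y : `|inner x y| <= n%:R * (`|x| * `|y|).
Proof.
apply: (le_trans (ler_norm_sum _ _ _)).
have -> : n%:R * (`|x| * `|y|) = \sum_(i < n) (`|x| * `|y|).
  by rewrite sumr_const card_ord mulr_natl.
by apply: ler_sum => i _; rewrite normrM ler_pM ?coord_le_norm.
Qed.

Lemma compact_sphere : compact (sphere R n).
Proof.
have -> : sphere R n = [set x : E | forall i, `[-1, 1]%classic (x ord0 i)] `&`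
    (fun x : E => inner x x) @^-1` [set 1].
  apply/seteqP; split => [x /sphereE x1|x [_ /= x1]]; last exact/sphereE.
  split => // i; rewrite /= in_itv/= -ler_norml.
  apply: le_trans (coord_le_norm _ _) _; apply: le_trans (norm_le_enorm _) _.
  by rewrite /enorm x1 sqrtr1.
apply: compact_closedI.
  exact: (@rV_compact _ n _ (fun=> @segment_compact R (-1) 1)).
apply: preimage_closed; last exact: closed_eq.
by move=> x _; apply: continuous_inner => ?; exact: cvg_id.
Qed.

End inner_product.

(** * Boundary points and normals of a convex body *)

Section convex_body.
Variables (R : realType) (n : nat) (K : set 'rV[R]_n).
Local Notation E := 'rV[R]_n.
Hypotheses (hK : convex_body K) (hK0 : K° 0).
Implicit Types (x y z u v : E).

Let compactK : compact K. Proof. by case: hK. Qed.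

Let closedK : closed K.
Proof. exact: compact_closed (@norm_hausdorff _ _) compactK. Qed.

Let K0 : K 0. Proof. exact: interior_subset hK0. Qed.

Let K_nonempty : K !=set0. Proof. by exists 0. Qed.

Lemma body_segment x y (s : R) : 0 <= s -> s <= 1 -> K x -> K y ->
  K (x + s *: (y - x)).
Proof.
move=> s0 s1 Kx Ky.
have s01 : Itv.spec (@Itv.num_sem R) (Itv.Real `[0%Z, 1%Z]) s.
  by rewrite /= /Itv.num_sem/= num_real/= in_itv/= s0 s1.
have [_ cK _] := hK.
have := cK y x (Itv.mk s01) (mem_set Ky) (mem_set Kx); rewrite inE.
rewrite /conv/= => H.
suff -> : x + s *: (y - x) = s *: y + (1 - s) *: x by [].
by apply/rowP => i; rewrite !mxE; ring.
Qed.

Lemma bdP x : bd K x <-> K x /\ ~ K° x.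
Proof. by rewrite /bd -(closure_id K).1. Qed.

Lemma compact_bd : compact (bd K).
Proof.
rewrite /bd -(closure_id K).1// setDE; apply: compact_closedI => //.
by apply: open_closedC; exact: open_interior.
Qed.

Lemma interior_step x w : K° x -> exists2 e : R, 0 < e & K (x + e *: w).
Proof.
move=> /nbhs_ballP[d /= d0 xK]; exists (d / (1 + `|w|)).
  by rewrite divr_gt0// ltr_pwDl.
apply: xK; rewrite -ball_normE/= opprD addrA subrr add0r normrN normrZ.
rewrite gtr0_norm; last by rewrite divr_gt0// ltr_pwDl.
have w1 : 0 < 1 + `|w| by rewrite ltr_pwDl.
by rewrite mulrAC ltr_pdivrMr// ltr_pM2l// ltrDr.
Qed.

Lemma support_fun_max u : exists2 x, K x &
  support_fun K u = inner u x /\ forall y, K y -> inner u y <= inner u x.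
Proof.
have cu : continuous (fun y : E => inner u y).
  by apply: continuous_inner => y; [exact: cst_continuous|exact: cvg_id].
have [x xK max] := compact_EVT_max K_nonempty compactK
  (continuous_subspaceT cu).
move: xK; rewrite inE => Kx; have {}max y : K y -> inner u y <= inner u x.
  by move=> Ky; apply: max; rewrite inE.
exists x => //; split => //; apply/eqP; rewrite eq_le; apply/andP; split.
  apply: ge_sup; first by exists (inner u 0); exists 0.
  by move=> _ [y Ky <-]; exact: max.
apply: ub_le_sup; last by exists x.
by exists (inner u x) => _ [y Ky <-]; exact: max.
Qed.

Lemma le_support_fun u y : K y -> inner u y <= support_fun K u.
Proof. by move=> Ky; have [x Kx [-> max]] := support_fun_max u; exact: max. Qed.

Lemma outer_normalP x u : outer_normal K x u <->
  [/\ bd K x, sphere R n u & forall y, K y -> inner (y - x) u <= 0].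
Proof.
split=> -[bx su].
  move=> xu; split => // y Ky.
  by rewrite innerBl subr_le0 xu innerC le_support_fun.
move=> xu; split => //; apply/eqP; rewrite eq_le; apply/andP; split.
  by rewrite innerC; apply: le_support_fun; have /bdP[] := bx.
have [y Ky [-> _]] := support_fun_max u.
by have := xu y Ky; rewrite innerBl subr_le0 innerC.
Qed.

Lemma body_normal_bd x u : sphere R n u -> K x ->
  (forall y, K y -> inner (y - x) u <= 0) -> outer_normal K x u.
Proof.
move=> su Kx xu; apply/outer_normalP; split => //; apply/bdP; split => //.
move=> /(@interior_step _ u)[e e0 /xu].
rewrite addrC addKr innerZl; have /sphereE -> := su.
by rewrite mulr1 leNgt e0.
Qed.

Lemma support_fun_gt0 u : sphere R n u -> 0 < support_fun K u.
Proof.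
move=> su; have [e e0 Ke] := interior_step u hK0.
apply: lt_le_trans (le_support_fun u Ke).
by rewrite add0r innerZr; have /sphereE -> := su; rewrite mulr1.
Qed.

Lemma exists_contact u : sphere R n u -> exists x, outer_normal K x u.
Proof.
move=> su; have [x Kx [_ max]] := support_fun_max u.
exists x; apply: body_normal_bd => // y Ky.
by rewrite innerBl subr_le0 -!(innerC u) max.
Qed.

(** The normal cone of K at x, including the zero vector. *)
Definition normal_vector x w := K x /\ forall y, K y -> inner (y - x) w <= 0.

(** Monotonicity of the normal cone: the cross term in the expansion of the
    right-hand side is nonnegative. So a + w determines both a and w, each
    depending on it in a nonexpansive way; the first is the nearest point
    projection. *)
Lemma normal_vector_nonexpansive a w a' w' :
  normal_vector a w -> normal_vector a' w' ->
  inner (a - a') (a - a') + inner (w - w') (w - w') <=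
  inner (a + w - (a' + w')) (a + w - (a' + w')).
Proof.
move=> [Ka aw] [Ka' aw']; have := aw _ Ka'; have := aw' _ Ka.
have -> : a + w - (a' + w') = (a - a') + (w - w') by rewrite opprD addrACA.
move: (innerC (a - a') (w - w')).
by rewrite !innerE => *; lra.
Qed.

Lemma nearest_point z : exists y, normal_vector y (z - y).
Proof.
have cz : continuous (fun y : E => inner (z - y) (z - y)).
  suff czy : continuous (fun y : E => z - y) by exact: continuous_inner.
  by move=> y; apply: continuousB; [exact: cst_continuous|exact: cvg_id].
have [y yK min] := compact_EVT_min K_nonempty compactK
  (continuous_subspaceT cz).
move: yK; rewrite inE => Ky; exists y; split => // k Kk.
rewrite leNgt; apply/negP => ky0.
set c := inner (k - y) (z - y) in ky0; pose d := inner (k - y) (k - y).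
have d0 : 0 <= d by exact: inner_ge0.
(* a step so short that moving from y towards k decreases the distance to z *)
pose s := Num.min 1 (c / (1 + d)).
have s0 : 0 < s by rewrite lt_min ltr01 divr_gt0//; lra.
have s1 : s <= 1 by rewrite ge_min lexx.
have sc : s * d < 2 * c.
  have : s <= c / (1 + d) by rewrite ge_min lexx orbT.
  rewrite ler_pdivlMr; last lra.
  by nra.
have := min (y + s *: (k - y)); rewrite inE.
move=> /(_ (body_segment (ltW s0) s1 Ky Kk)).
have -> : z - (y + s *: (k - y)) = (z - y) - s *: (k - y).
  by rewrite opprD addrA.
rewrite [leRHS](_ : _ = inner (z - y) (z - y) + s * (s * d - 2 * c)).
  rewrite lerDl leNgt pmulr_rlt0//; lra.
rewrite /d /c (innerBl (z - y)) (innerBr _ _ (z - y)).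
rewrite (innerBr _ _ (s *: (k - y))) !innerZl !innerZr (innerC (z - y) (k - y)).
ring.
Qed.

Definition normal_bundle : set (E * E) := [set z | outer_normal K z.1 z.2].

Lemma compact_normal_bundle : compact normal_bundle.
Proof.
have -> : normal_bundle = (bd K `*` sphere R n) `&`
    \bigcap_(y in K)
      (fun z : E * E => inner (y - z.1) z.2) @^-1` [set t | t <= 0].
  apply/seteqP; split => [[x u] /outer_normalP[bx su xu]|[x u] [[bx su] xu]].
    by split => // y Ky; exact: xu.
  by apply/outer_normalP; split => // y Ky; exact: xu.
apply: compact_closedI.
  by apply: compact_setX; [exact: compact_bd|exact: compact_sphere].
apply: closed_bigI => y Ky; apply: preimage_closed; last exact: closed_le.
move=> z _; apply: continuous_inner => t; last exact: cvg_snd.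
by apply: continuousB; [exact: cst_continuous|exact: cvg_fst].
Qed.

(** The supporting hyperplane theorem: points outside K tending to x have
    nearest points in K that tend to x and carry a normal. *)
Lemma exists_normal x : bd K x -> exists u, outer_normal K x u.
Proof.
move=> bx; have /bdP[Kx nKx] := bx.
suff : closure (fst @` normal_bundle) x.
  rewrite -(closure_id _).1; first by case=> -[y u] /= yu <-; exists u.
  apply: compact_closed (@norm_hausdorff _ _) _; apply: continuous_compact.
    by apply: continuous_subspaceT => ?; exact: cvg_fst.
  exact: compact_normal_bundle.
move=> B /nbhs_ballP[e /= e0 xB].
have n0 : 0 < 1 + n%:R :> R by rewrite ltr_pwDl.
have [z xz nKz] : exists2 z, ball x (e / (1 + n%:R)) z & ~ K z.
  apply: contrapT => /forall2NP H; apply: nKx.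
  apply/nbhs_ballP; exists (e / (1 + n%:R)) => /=; first by rewrite divr_gt0.
  by move=> z xz; have [//|/contrapT] := H z.
have [y yz] := nearest_point z.
have zy0 : z - y != 0.
  by rewrite subr_eq0; apply: contra_notN nKz => /eqP ->; case: yz.
have Nzy : 0 < enorm (z - y).
  by rewrite lt_neqAle enorm_ge0 andbT eq_sym sqrtr_eq0 -ltNge inner_gt0.
pose u := (enorm (z - y))^-1 *: (z - y).
have xw : normal_vector x 0.
  by split => // k _; rewrite -(scale0r (0 : E)) innerZr mul0r.
have xy : `|x - y| < e.
  apply: le_lt_trans (norm_le_enorm _) _.
  apply: (@le_lt_trans _ _ (enorm (x - z))).
    apply: le_enorm; have := normal_vector_nonexpansive xw yz.
    rewrite addr0 (addrC y) subrK; apply: le_trans.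
    by rewrite lerDl inner_ge0.
  apply: (le_lt_trans (enorm_le_norm _)).
  move: xz; rewrite -ball_normE/= ltr_pdivlMr//; apply: le_lt_trans.
  by rewrite mulrC ler_wpM2l// lerDr.
exists y; split; last by apply: xB; rewrite -ball_normE.
exists (y, u) => //=; apply: body_normal_bd.
- by apply/sphereE; rewrite innerZl innerZr -sqr_enorm; field; rewrite gt_eqF.
- by case: yz.
- move=> k Kk; rewrite innerZr pmulr_rle0 ?invr_gt0//.
  by case: yz => _; exact.
Qed.

(** Two unit vectors are dependent only when they are equal or opposite. *)
Lemma gram_sphere u v : sphere R n u -> sphere R n v ->
  0 < inner u u + inner u v -> u != v ->
  inner u u * inner v v != inner u v ^+ 2.
Proof.
move=> /sphereE u1 /sphereE v1; rewrite u1 v1 => uv uNv.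
have := @inner_gt0 _ _ (u - v); rewrite subr_eq0 => /(_ uNv).
rewrite !innerE u1 v1 (innerC v u) => uv1.
by apply/eqP => uv2; nra.
Qed.

(** The nearest point projection maps x + s u + t v to x for all s, t >= 0, a
    thick fibre when the normals u and v are distinct. *)
Lemma singular_points_null :
  hausdorff n.-1 [set x | exists u v,
    [/\ u != v, outer_normal K x u & outer_normal K x v]] = 0%E.
Proof.
apply: (@thick_fibre_null _ _ _ (fun a z => normal_vector a (z - a))).
  move=> a z a' z' az az'; apply: le_enorm.
  have := normal_vector_nonexpansive az az'.
  rewrite !(addrC _ (_ - _)) !subrK; apply: le_trans.
  by rewrite lerDl inner_ge0.
move=> x [u [v [uv /outer_normalP[bx su xu] /outer_normalP[_ sv xv]]]].
exists (x + u + v), u, v, 1 => //; split.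
  apply: gram_sphere => //.
  have u1 : inner u u = 1 by apply/sphereE.
  have v1 : inner v v = 1 by apply/sphereE.
  have [e e0 Ke] := interior_step (u + v) hK0.
  have := @inner_ge0 _ _ (u + v).
  rewrite u1 !innerE u1 v1 (innerC v u) => uv0.
  rewrite lt_neqAle; apply/andP; split; last lra.
  apply/eqP => uv1.
  (* u + v = 0 is impossible, as h_K is positive at u and at v *)
  have : u + v = 0 by apply: inner_eq0; rewrite !innerE u1 v1 (innerC v u); lra.
  move=> /eqP; rewrite addr_eq0 => /eqP uE.
  have hu : 0 < inner x u.
    have [_ _ ->] : outer_normal K x u by apply/outer_normalP.
    exact: support_fun_gt0.
  have hv : 0 < inner x v.
    have [_ _ ->] : outer_normal K x v by apply/outer_normalP.
    exact: support_fun_gt0.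
  by move: hu; rewrite uE innerNr; lra.
move=> s t; rewrite !ler_norml => /andP[s1 _] /andP[t1 _].
split; first by have /bdP[] := bx.
move=> y Ky.
have -> : x + u + v + s *: u + t *: v - x = (1 + s) *: u + (1 + t) *: v.
  by apply/rowP => i; rewrite !mxE; ring.
rewrite innerDr !innerZr.
have := xu _ Ky; have := xv _ Ky; nra.
Qed.

(** Dually, at distance at least 1 from K the direction from the nearest point
    is a nonexpansive function of position, and equals u on the strip spanned
    by the segment [x, y] and the direction u when u is normal at both x and
    y. *)
Lemma singular_normals_null :
  hausdorff n.-1 [set u | exists x y,
    [/\ x != y, outer_normal K x u & outer_normal K y u]] = 0%E.
Proof.
apply: (@thick_fibre_null _ _ _ (fun u z => sphere R n u /\ exists x t,
    [/\ 1 <= t, normal_vector x (t *: u) & z = x + t *: u])).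
  move=> u z u' z' [/sphereE u1 [x [t [t1 xt ->]]]]
    [/sphereE u1' [x' [t' [t1' xt' ->]]]].
  apply: le_enorm.
  apply: le_trans (normal_vector_nonexpansive xt xt').
  have := @inner_ge0 _ _ (u - u'); have := @inner_ge0 _ _ (x - x').
  move: (inner (x - x') (x - x')) => c c0.
  rewrite !innerE u1 u1' (innerC u' u); move: (inner u u') => b bb.
  (* |t u - t' u'|^2 = (t - t')^2 + t t' |u - u'|^2 *)
  have tt : 1 <= t * t' by nra.
  have := sqr_ge0 (t - t'); nra.
move=> u [x [y [xy /outer_normalP[bx su xu] /outer_normalP[by1 _ yu]]]].
have [Kx Ky] : K x /\ K y by split; [have /bdP[] := bx|have /bdP[] := by1].
have xyu : inner (y - x) u = 0.
  apply/eqP; rewrite eq_le xu//=; have := yu _ Kx.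
  by rewrite -opprB innerNl; lra.
exists (x + 2^-1 *: (y - x) + 2%:R *: u), (y - x), u, 2^-1 => //; split.
  have /sphereE -> := su; rewrite xyu expr0n/= mulr1 gt_eqF// inner_gt0//.
  by rewrite subr_eq0 eq_sym.
move=> s t; rewrite !ler_norml => /andP[s1 s2] /andP[t1 t2]; split => //.
exists (x + (2^-1 + s) *: (y - x)), (2 + t); split.
- lra.
- split; first by apply: body_segment => //; lra.
  move=> k Kk; rewrite innerZr opprD addrA innerBl innerZl xyu mulr0 subr0.
  by have := xu _ Kk; nra.
- by apply/rowP => i; rewrite !mxE; ring.
Qed.

End convex_body.

(** * Continuous envelopes and their integrals *)

Lemma lipschitz_continuous (R : realType) (V : normedModType R) (f : V -> R)
    (c : R) : 0 <= c -> (forall x y, f x <= f y + c * `|x - y|) -> continuous f.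
Proof.
move=> c0 lip x; apply/cvgrPdist_le => e e0.
have k0 : 0 < 1 + c by rewrite ltr_pwDl.
near=> y.
have xy : c * `|x - y| <= e.
  apply: (@le_trans _ _ ((1 + c) * `|x - y|)).
    by rewrite ler_wpM2r// lerDr.
  rewrite -ler_pdivlMl// mulrC.
  near: y; move: (e / _) (divr_gt0 e0 k0).
  by apply/cvgrPdist_le; exact: cvg_id.
have := lip x y; have := lip y x.
rewrite (distrC y x) ler_norml => h1 h2; apply/andP; split.
- by rewrite lerBrDr addrC lerBlDr (le_trans h1)// lerD2l.
- by rewrite lerBlDr addrC (le_trans h2)// lerD2l.
Unshelve. all: by end_near. Qed.

Section envelope.
Variables (R : realType) (V W : normedModType R).
Variables (G : set (V * W)) (phi : W -> R) (M : R).
Hypotheses (G_compact : compact G) (G_neq0 : G !=set0).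
Hypothesis phi_le : forall z, G z -> phi z.2 <= M.

(** The relation G turns phi into the function sending x to the largest value
    of phi over the partners of x, which is only upper semicontinuous; its
    Lipschitz regularizations decrease to it as k grows. *)
Definition envelope (k : nat) (x : V) : R :=
  sup [set phi z.2 - k%:R * `|x - z.1| | z in G].

Lemma envelope_ub k x z : G z -> phi z.2 - k%:R * `|x - z.1| <= envelope k x.
Proof.
move=> Gz; apply: ub_le_sup; last by exists z.
exists M => _ [w Gw <-]; rewrite lerBlDr; apply: le_trans (phi_le Gw) _.
by rewrite lerDl mulr_ge0.
Qed.

Lemma envelope_ge k x v : G (x, v) -> phi v <= envelope k x.
Proof.
by move=> Gxv; have := envelope_ub k x Gxv; rewrite /= subrr normr0 mulr0 subr0.
Qed.

Lemma envelope_le_sup k x c :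
  (forall z, G z -> phi z.2 - k%:R * `|x - z.1| <= c) -> envelope k x <= c.
Proof.
move=> Gc; apply: ge_sup; last by move=> _ [z Gz <-]; exact: Gc.
by have [z Gz] := G_neq0; exists (phi z.2 - k%:R * `|x - z.1|), z.
Qed.

Lemma envelope_le k x : envelope k x <= M.
Proof.
apply: envelope_le_sup => z Gz; rewrite lerBlDr.
by apply: le_trans (phi_le Gz) _; rewrite lerDl mulr_ge0.
Qed.

Lemma envelope_lip k x y : envelope k x <= envelope k y + k%:R * `|x - y|.
Proof.
apply: envelope_le_sup => z Gz.
rewrite -lerBlDr -addrA -opprD -mulrDr; apply: le_trans (envelope_ub k y Gz).
rewrite lerD2l lerN2 ler_wpM2l// (addrC `|x - z.1|) (distrC x y).
exact: ler_distD.
Qed.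

Lemma continuous_envelope k : continuous (envelope k).
Proof. by apply: (lipschitz_continuous (ler0n R k)); exact: envelope_lip. Qed.

(** The pairs of G whose value exceeds phi v by a fixed amount form a compact
    set, and x, whose only partner is v, is not the first member of any of
    them; so such pairs have first members at positive distance from x, and a
    large k discards them. *)
Lemma cvg_envelope (Y : set W) x v :
  {within Y, continuous phi} -> (forall z, G z -> Y z.2) ->
  G (x, v) -> (forall u, G (x, u) -> u = v) ->
  envelope ^~ x @ \oo --> phi v.
Proof.
move=> phic GY Gxv uniq; apply/cvgrPdist_le => e e0.
have [F clF FY] : exists2 F : set W, closed F &
    F `&` Y = phi @^-1` `[phi v + e, +oo[ `&` Y.
  apply/closed_subspaceP; move/continuous_closedP: phic; apply.
  exact: interval_closed.
pose B := G `&` (snd @^-1` F).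
have BE z : B z <-> G z /\ phi v + e <= phi z.2.
  split=> -[Gz] h; split => //.
    have : (F `&` Y) z.2 by split => //; exact: GY.
    by rewrite FY => -[/=]; rewrite in_itv/= andbT.
  have : (phi @^-1` `[phi v + e, +oo[ `&` Y) z.2.
    by split; [rewrite /= in_itv/= andbT|exact: GY].
  by rewrite -FY => -[].
have cB : closed (fst @` B).
  apply: compact_closed; first exact: norm_hausdorff.
  apply: continuous_compact.
    by apply: continuous_subspaceT => ?; exact: cvg_fst.
  apply: compact_closedI => //; apply: preimage_closed => // z _.
  exact: cvg_snd.
have xB : ~ (fst @` B) x.
  move=> [[y u] /BE[Gyu /= yu] /= yx]; rewrite yx in Gyu.
  by move: yu; rewrite (uniq u Gyu); rewrite gerDl leNgt e0.
have /nbhs_ballP[d /= d0 xd] : nbhs x (~` (fst @` B)).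
  by apply: open_nbhs_nbhs; split => //; exact: closed_openC.
near=> k.
have kx := envelope_ge k Gxv.
rewrite distrC ger0_norm ?subr_ge0// lerBlDr addrC.
apply: envelope_le_sup => z Gz.
have [xz|xz] := ltP `|x - z.1| d.
  rewrite lerBlDr; apply: (@le_trans _ _ (phi v + e)); last first.
    by rewrite lerDl mulr_ge0.
  apply/ltW; rewrite ltNge; apply/negP => h.
  by apply: (xd z.1); [rewrite -ball_normE|exists z => //; apply/BE].
rewrite lerBlDr; apply: le_trans (phi_le Gz) _.
have kd : M - phi v - e <= k%:R * d.
  rewrite -ler_pdivrMr//; near: k; exact: nbhs_infty_ger.
apply: (@le_trans _ _ (phi v + e + k%:R * d)).
  by rewrite -lerBlDl opprD addrA.
by rewrite lerD2l ler_wpM2l.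
Unshelve. all: by end_near. Qed.

End envelope.

Section integration.
Import HBNNSimple.
Local Open Scope ereal_scope.

(** A nonnegative simple function below a function vanishing off D has its
    nonzero level sets inside D. This compares integrals against set functions
    of which only the values on measurable subsets of D are known. *)
Lemma eq_set_function_integral d (T : measurableType d) (R : realType)
    (D : set T) (m1 m2 : set T -> \bar R) (f : T -> \bar R) :
  (forall A, measurable A -> A `<=` D -> m1 A = m2 A) ->
  \int[m1]_(x in D) f x = \int[m2]_(x in D) f x.
Proof.
move=> m12.
have H (g : T -> \bar R) : (forall x, ~ D x -> g x = 0) ->
    let below := [set h : {nnsfun T >-> R} | forall x, (h x)%:E <= g x] in
    [set sintegral m1 h | h in below] = [set sintegral m2 h | h in below].
  move=> gD /=; have S (h : {nnsfun T >-> R}) : (forall x, (h x)%:E <= g x) ->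
      sintegral m1 h = sintegral m2 h.
    move=> hg; apply: eq_fsbigr => r _.
    have [->|r0] := eqVneq r 0%R; first by rewrite !mul0e.
    congr (_ * _); apply: m12; first exact: measurable_sfunP.
    move=> x /= hx; apply: contrapT => /gD gx0.
    have := hg x; rewrite gx0 lee_fin => hx0.
    by move: r0; rewrite -hx eq_le hx0 fun_ge0.
  by apply/seteqP; split=> _ [h hg <-]; exists h => //; rewrite S.
rewrite /integral; congr (ereal_sup _ - ereal_sup _); apply: H => x Dx.
  by rewrite funeposE patchE memNset// maxxx.
by rewrite funenegE patchE memNset// oppe0 maxxx.
Qed.

(** Where the integral of f is finite so is the measure of D, as f is bounded
    below, and then dominated convergence applies; the ratio form also covers
    the degenerate cases of an infinite or a null D. *)
Lemma integral_limit_ratio d (T : measurableType d) (R : realType)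
    (mu : {measure set T -> \bar R}) (D : set T) (f_ : nat -> T -> R)
    (f : T -> R) (m M : R) : measurable D ->
  (forall k, measurable_fun D (f_ k)) -> measurable_fun D f -> (0 < m)%R ->
  (forall x, D x -> (m <= f x)%R) ->
  (forall k x, D x -> (0 <= f_ k x <= M)%R) ->
  (forall x, D x -> f_ ^~ x @ \oo --> f x) ->
  forall c : R, (1 < c)%R -> exists k,
    \int[mu]_(x in D) (f_ k x)%:E <= c%:E * \int[mu]_(x in D) (f x)%:E.
Proof.
move=> mD mf_ mf m0 fm fM f_f c c1.
have mEf_ k : measurable_fun D (fun x => (f_ k x)%:E) by exact/measurable_EFinP.
have mEf : measurable_fun D (fun x => (f x)%:E) by exact/measurable_EFinP.
have f0 x : D x -> 0 <= (f x)%:E.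
  by move=> Dx; rewrite lee_fin (le_trans _ (fm x Dx))// ltW.
have [->|Ioo] := eqVneq (\int[mu]_(x in D) (f x)%:E) +oo.
  by exists 0%N; rewrite gt0_muley ?leey// lte_fin (lt_trans ltr01).
have mI : m%:E * mu D <= \int[mu]_(x in D) (f x)%:E.
  rewrite -integral_cst//; apply: ge0_le_integral => //.
  - by move=> x _; rewrite lee_fin ltW.
have f_M k : \int[mu]_(x in D) (f_ k x)%:E <= M%:E * mu D.
  rewrite -integral_cst//; apply: ge0_le_integral => //.
  - by move=> x Dx; rewrite lee_fin; case/andP: (fM k x Dx).
  - by move=> x Dx; rewrite lee_fin; case/andP: (fM k x Dx).
have I0 : 0 <= \int[mu]_(x in D) (f x)%:E by exact: integral_ge0.
have Dfin : mu D < +oo.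
  rewrite ltey; apply: contra Ioo => /eqP muD.
  by move: mI; rewrite muD gt0_muley ?lte_fin// leye_eq.
have [I00|Ipos] := eqVneq (\int[mu]_(x in D) (f x)%:E) 0.
  exists 0%N; rewrite I00 mule0; apply: le_trans (f_M 0%N) _.
  suff -> : mu D = 0 by rewrite mule0.
  apply/eqP; rewrite eq_le measure_ge0 andbT.
  by rewrite -(@lee_pmul2l _ m%:E) ?lte_fin// mule0 -I00.
have Ifin : \int[mu]_(x in D) (f x)%:E \is a fin_num.
  by rewrite ge0_fin_numE// lt_neqAle Ioo leey.
have iM : mu.-integrable D (cst `|M|%:E).
  apply/integrableP; split => //.
  under eq_integral do rewrite /= normr_id.
  by rewrite integral_cst// lte_mul_pinfty// lee_fin.
have ae_cvg :
    {ae mu, forall x, D x -> (fun k => (f_ k x)%:E) @ \oo --> (f x)%:E}.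
  by apply: aeW => x Dx; apply: cvg_EFin; [exact: nearW|exact: f_f].
have ae_bound : {ae mu, forall x k, D x -> `|(f_ k x)%:E| <= `|M|%:E}.
  apply: aeW => x k Dx; case/andP: (fM k x Dx) => h1 h2.
  by rewrite abse_EFin lee_fin ger0_norm// (le_trans h2)// ler_norm.
have [_ _ cvgI] := dominated_convergence mD mEf_ mEf ae_cvg iM ae_bound.
apply: contrapT => /forallNP H.
have : c%:E * \int[mu]_(x in D) (f x)%:E <= \int[mu]_(x in D) (f x)%:E.
  rewrite -[leRHS](cvg_lim _ cvgI)//; apply: lime_ge.
    by apply/cvg_ex; exists (\int[mu]_(x in D) (f x)%:E).
  by apply: nearW => k; have /negP := H k; rewrite -ltNge => /ltW.
move: I0 Ipos; rewrite -(fineK Ifin) -EFinM !lee_fin eqe => I0 Ipos.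
rewrite ger_pMl ?lt_neqAle ?I0 1?eq_sym ?Ipos//.
by rewrite leNgt c1.
Qed.

End integration.

(** * Almost one-to-one compact correspondences *)

Section positive_continuous.
Variables (R : realType) (n : nat).
Local Notation E := 'rV[R]_n.

Lemma closed_measurableRn (A : set E) :
  closed A -> measurable (A : set (borelRn R n)).
Proof.
move=> cA; rewrite -[A]setCK; apply: (@measurableC _ (borelRn R n)).
by apply: sub_sigma_algebra; exact: closed_openC.
Qed.

Lemma within_continuous_measurable (D : set E) (f : E -> R) : closed D ->
  {within D, continuous f} ->
  measurable_fun (D : set (borelRn R n)) (f : borelRn R n -> R).
Proof.
move=> cD cf; apply: (measurability _ (RGenCInfty.measurableE R)).
move=> _ [_ [a ->] <-].
have [F clF FD] : exists2 F : set E, closed F &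
    F `&` D = f @^-1` `[a, +oo[ `&` D.
  apply/closed_subspaceP; move/continuous_closedP: cf; apply.
  exact: interval_closed.
rewrite setIC -FD; apply: closed_measurableRn; exact: closedI.
Qed.

Lemma cvg_powR (T : Type) (F : set_system T) {FF : Filter F} (f : T -> R)
    (a q : R) : 0 < a -> f @ F --> a -> (fun t => f t `^ q) @ F --> a `^ q.
Proof.
move=> a0; apply: (@continuous_cvg _ _ _ _ _ _ (fun t : R => t `^ q)).
apply: differentiable_continuous; apply/derivable1_diffP.
by apply: derivable_powR; rewrite in_itv/= a0.
Qed.

Lemma pos_continuous_powR (D : set E) (f : E -> R) (q : R) :
  pos_continuous_on D f -> pos_continuous_on D (fun x => f x `^ q).
Proof.
move=> [cf f0]; split => [|x Dx]; last by rewrite powR_gt0// f0.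
apply/subspace_continuousP => x Dx; apply: cvg_powR. exact: f0.
by move/subspace_continuousP: cf; exact.
Qed.

Lemma pos_continuousV (D : set E) (f : E -> R) :
  pos_continuous_on D f -> pos_continuous_on D (fun x => (f x)^-1).
Proof.
move=> [cf f0]; split => [|x Dx]; last by rewrite invr_gt0 f0.
apply/subspace_continuousP => x Dx; apply: cvgV.
  exact: lt0r_neq0 (f0 _ Dx).
by move/subspace_continuousP: cf; exact.
Qed.

Lemma pos_continuous_bounds (D : set E) (f : E -> R) : compact D ->
  pos_continuous_on D f ->
  exists m M : R, [/\ 0 < m, 0 < M & forall x, D x -> m <= f x <= M].
Proof.
move=> cD [cf f0]; have [D0|/set0P/negP/negPn/eqP ->] := pselect (D !=set0).
  have [x1 + f1] := compact_EVT_min D0 cD cf.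
  have [x2 + f2] := compact_EVT_max D0 cD cf.
  rewrite !inE => D2 D1; exists (f x1), (f x2); split; [exact: f0..|].
  by move=> x Dx; rewrite f1 ?f2 ?inE.
by exists 1, 1; split.
Qed.

End positive_continuous.

Section correspondence.
Variables (R : realType) (n : nat).
Local Notation E := 'rV[R]_n.
Local Notation B := (borelRn R n).
Variable T : E -> E -> Prop.

Definition regular : set E := [set x | exists u, T x = [set u]].

Definition singular : set E := [set x | exists u v, [/\ u != v, T x u & T x v]].

(** For the relation of outer normality this is the Gauss map. *)
Definition partner (x : E) : E := xget 0 [set u | T x = [set u]].

Lemma partnerE x : regular x -> T x = [set partner x].
Proof. by move=> rx; exact: (xgetPex 0 rx). Qed.

Lemma partnerP x : regular x -> T x (partner x).
Proof. by move=> /partnerE ->. Qed.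

Lemma partner_default x : ~ regular x -> partner x = 0.
Proof. by move=> nrx; apply: xgetPN => u xu; apply: nrx; exists u. Qed.

Lemma regularE : regular = [set x | exists u, T x u] `\` singular.
Proof.
apply/seteqP; split => [x rx|x [[u xu] nsx]].
  split; first by exists (partner x); exact: partnerP.
  move=> [u [v [uv xu xv]]]; move: xu xv uv; rewrite (partnerE rx) /= => -> ->.
  by rewrite eqxx.
exists u; apply/seteqP; split => [v xv|_ ->//].
apply: contrapT => /= vu; apply: nsx; exists u, v; split => //.
by apply/eqP => uv; apply: vu.
Qed.

Hypothesis compactT : compact [set z : E * E | T z.1 z.2].
Local Notation graph := [set z : E * E | T z.1 z.2].

Let closed_fst (F : set E) :
  closed F -> closed (fst @` (graph `&` snd @^-1` F)).
Proof.
move=> cF; apply: compact_closed; first exact: norm_hausdorff.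
apply: continuous_compact.
  by apply: continuous_subspaceT => ?; exact: cvg_fst.
apply: compact_closedI => //; apply: preimage_closed => // z _; exact: cvg_snd.
Qed.

(** The singular points whose partners lie at distance at least 1/(m+1) form a
    compact set. *)
Lemma measurable_singular : measurable (singular : set B).
Proof.
pose P (m : nat) : set ((E * E) * (E * E)) := (graph `*` graph) `&`
  ((fun w => w.1.1 - w.2.1) @^-1` [set 0] `&`
   (fun w => `|w.1.2 - w.2.2|) @^-1` [set t | m.+1%:R^-1 <= t]).
have -> : singular = \bigcup_m ((fun w : (E * E) * (E * E) => w.1.1) @` P m).
  apply/seteqP; split => [x [u [v [uv xu xv]]]|x [m _ [[[a u] [b v]] /=]]].
    have uv0 : 0 < `|u - v| by rewrite normr_gt0 subr_eq0.
    exists (Num.truncn `|u - v|^-1) => //.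
    exists ((x, u), (x, v)) => //; split => //; split => /=.
      by rewrite subrr.
    by rewrite invf_ple ?posrE ?ltr0n// ltW// -truncn_lt_nat// invr_ge0.
  move=> [[/= au bv] [/= /eqP]]; rewrite subr_eq0 => /eqP ab uv <-.
  exists u, v; split => //; last by rewrite ab.
  apply: contraTN uv => /eqP ->; rewrite subrr normr0 -ltNge.
  by rewrite invr_gt0 ltr0n.
apply: bigcup_measurable => m _; apply: closed_measurableRn.
apply: compact_closed; first exact: norm_hausdorff.
pose EE := (E * E)%type.
have c1 : continuous (fst : EE * EE -> EE) by move=> w; exact: cvg_fst.
have c2 : continuous (snd : EE * EE -> EE) by move=> w; exact: cvg_snd.
have d1 : continuous (fst : EE -> E) by move=> w; exact: cvg_fst.
have d2 : continuous (snd : EE -> E) by move=> w; exact: cvg_snd.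
have c11 (w : EE * EE) := continuous_comp (c1 w) (d1 w.1).
have c12 (w : EE * EE) := continuous_comp (c1 w) (d2 w.1).
have c21 (w : EE * EE) := continuous_comp (c2 w) (d1 w.2).
have c22 (w : EE * EE) := continuous_comp (c2 w) (d2 w.2).
apply: continuous_compact.
  by apply: continuous_subspaceT => w; exact: c11.
apply: compact_closedI; first exact: compact_setX.
apply: closedI; apply: preimage_closed; 
  [|exact: compact_closed (@norm_hausdorff _ _) (@compact_set1 _ _)|
   |exact: closed_ge].
- by move=> w _; apply: cvgB; [exact: c11|exact: c21].
- by move=> w _; apply: cvg_norm; apply: cvgB; [exact: c12|exact: c22].
Qed.

Lemma measurable_regular : measurable (regular : set B).
Proof.
rewrite regularE; apply: (@measurableD _ B); last exact: measurable_singular.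
rewrite [X in measurable X](_ : _ = fst @` (graph `&` snd @^-1` setT)).
  by apply: closed_measurableRn; apply: closed_fst; exact: closedT.
apply/seteqP; split => [x [u xu]|x [[y u] [/= yu _] <-]]; last by exists u.
by exists (x, u).
Qed.

(** The regular points sent into a closed set F are those in the projection of
    the part of the graph above F, which is compact. *)
Lemma measurable_partner : measurable_fun setT (partner : B -> B).
Proof.
apply: (@measurability _ _ B B setT partner (@open E)) => //.
move=> _ [U oU <-]; rewrite setTI.
rewrite -[U]setCK preimage_setC; apply: (@measurableC _ B).
pose F := ~` U; have cF : closed F by exact: open_closedC.
rewrite -/F [X in measurable X](_ : _ =
   (regular `&` fst @` (graph `&` snd @^-1` F)) `|`
   (~` regular `&` [set x | F 0])).
  apply: (@measurableU _ B); apply: (@measurableI _ B).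
  - exact: measurable_regular.
  - by apply: closed_measurableRn; exact: closed_fst.
  - by apply: (@measurableC _ B); exact: measurable_regular.
  - have [F0|F0] := pselect (F 0).
      rewrite [X in measurable X](_ : _ = setT).
        exact: (@measurableT _ B).
      by apply/seteqP; split.
    rewrite [X in measurable X](_ : _ = set0).
      exact: (@measurable0 _ B).
    by apply/seteqP; split.
apply/seteqP; split => [x /= Fx|x [[rx [[y u] [/= yu Fu] yx]]|[nrx F0]]] /=.
- have [rx|nrx] := pselect (regular x); [left|right].
    by split => //; exists (x, partner x) => //; split => //; exact: partnerP.
  by split => //=; rewrite -(partner_default nrx).
- by move: yu; rewrite yx (partnerE rx) => <-.
- by rewrite (partner_default nrx).
Qed.

Variable s : nat.
Local Notation H := (@hausdorff R n s).
Hypothesis singular0 : H singular = 0%E.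
Local Open Scope ereal_scope.

(** The surface area measure and C_0 both have this form, for the relation of
    outer normality and for its transpose. *)
Definition preimage_measure (w : set B) : \bar R :=
  H [set x | exists2 u, w u & T x u].

Lemma preimage_measureE (w : set B) :
  preimage_measure w = H (regular `&` partner @^-1` w).
Proof.
apply/eqP; rewrite eq_le; apply/andP; split; last first.
  apply: le_hausdorff => x [rx wx].
  by exists (partner x) => //; exact: partnerP.
apply: (@le_trans _ _ (H ((regular `&` partner @^-1` w) `|` singular))).
  apply: le_hausdorff => x [u wu xu].
  have [sx|nsx] := pselect (singular x); [by right|left].
  have rx : regular x by rewrite regularE; split => //; exists u.
  split => //=; move: xu; rewrite (partnerE rx) => /= <-; exact: wu.
apply: le_trans (outer_measureU2 (@hausdorff R n s) _ _) _.
by rewrite /= singular0 adde0.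
Qed.

(** Up to the null set of singular points, preimage_measure is the image of H
    under partner. The default value 0 of partner must stay outside D, or the
    points without a unique partner would contribute. *)
Lemma integral_preimage_measure (D : set B) (f : B -> \bar R) :
  measurable D -> measurable_fun D f -> (forall u, D u -> 0 <= f u) ->
  ~ D 0%R -> (forall x u, T x u -> D u) ->
  \int[preimage_measure]_(u in D) f u = \int[H]_(x in regular) f (partner x).
Proof.
move=> mD mf f0 D0 TD.
have preD : partner @^-1` D = regular.
  apply/seteqP; split => [x Dx|x rx]; last exact: TD (partnerP rx).
  by apply: contrapT => nrx; apply: D0; rewrite -(partner_default nrx).
rewrite (@eq_set_function_integral _ B R D preimage_measure
  (pushforward (H : {measure set B -> \bar R}) (partner : B -> B))).
  rewrite ge0_integral_pushforward//.
  - by rewrite preD.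
  - exact: measurable_partner.
  - by move=> u; rewrite inE => Du; exact: f0.
move=> A mA AD; rewrite preimage_measureE /pushforward.
by congr (H _); rewrite -preD; apply/setIidPr => x /AD.
Qed.

Lemma integral_regular (D : set B) (f : B -> \bar R) :
  measurable D -> measurable_fun D f -> (forall x, D x -> 0 <= f x) ->
  D = [set x | exists u, T x u] ->
  \int[H]_(x in D) f x = \int[H]_(x in regular) f x.
Proof.
move=> mD mf f0 DE.
rewrite (@ge0_negligible_integral _ B R (H : {measure set B -> \bar R}) D
  singular)//.
  by rewrite DE -regularE.
exact: measurable_singular.
Qed.

End correspondence.

(** * The four integrals of the theorem *)

Section transfer.
Variables (R : realType) (n s : nat).
Local Notation E := 'rV[R]_n.
Local Notation B := (borelRn R n).
Local Notation H := (@hausdorff R n s).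
Variables (T : E -> E -> Prop) (X Y : set E).
Hypothesis compactT : compact [set z : E * E | T z.1 z.2].
Hypothesis TXY : forall x u, T x u -> X x /\ Y u.
Hypothesis Tdom : forall x, X x -> exists u, T x u.
Hypotheses (cX : compact X) (cY : compact Y).

Let regularX x : regular T x -> X x.
Proof. by move=> /partnerP /TXY[]. Qed.

Let partnerY x : regular T x -> Y (partner T x).
Proof. by move=> /partnerP /TXY[]. Qed.

Lemma measurable_partner_comp (f : E -> R) : {within Y, continuous f} ->
  measurable_fun (regular T : set B) (fun x : B => f (partner T x)).
Proof.
move=> cf; apply: (@measurable_comp _ _ _ B B _ (Y : set B)).
- by apply: closed_measurableRn; exact: compact_closed (@norm_hausdorff _ _) cY.
- by move=> _ [x rx <-]; exact: partnerY.
- apply: within_continuous_measurable => //.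
  exact: compact_closed (@norm_hausdorff _ _) cY.
- apply: measurable_funTS; exact: measurable_partner.
Qed.

Lemma measurable_regular_fun (f : E -> R) : {within X, continuous f} ->
  measurable_fun (regular T : set B) (f : B -> R).
Proof.
move=> cf; apply: (@measurable_funS _ _ B _ (X : set B)).
- by apply: closed_measurableRn; exact: compact_closed (@norm_hausdorff _ _) cX.
- by move=> x; exact: regularX.
- apply: within_continuous_measurable => //.
  exact: compact_closed (@norm_hausdorff _ _) cX.
Qed.

Lemma envelope_sequence (phi : E -> R) : pos_continuous_on Y phi ->
  exists (f : nat -> E -> R) (M : R),
    [/\ forall k, pos_continuous_on X (f k),
        forall k x u, T x u -> phi u <= f k x,
        forall k x, X x -> f k x <= M &
        forall x, regular T x -> f ^~ x @ \oo --> phi (partner T x)].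
Proof.
move=> phiY; have [cphi phi0] := phiY.
have [m [M [m0 M0 mM]]] := pos_continuous_bounds cY phiY.
have [G0|/set0P/negP/negPn/eqP G0] :=
    pselect ([set z : E * E | T z.1 z.2] !=set0).
  have phiM (z : E * E) : T z.1 z.2 -> phi z.2 <= M.
    by move=> /TXY[_ /mM/andP[]].
  exists (envelope [set z : E * E | T z.1 z.2] phi), M; split.
  - move=> k; split.
      by apply: continuous_subspaceT; exact: (continuous_envelope G0 phiM).
    move=> x /Tdom[u xu]; have [_ Yu] := TXY xu.
    by apply: lt_le_trans (phi0 _ Yu) _; exact: (envelope_ge phiM).
  - by move=> k x u xu; exact: (envelope_ge phiM).
  - by move=> k x _; exact: (envelope_le G0 phiM).
  - move=> x rx; apply: (cvg_envelope compactT G0 phiM cphi).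
    + by move=> z /= /TXY[].
    + exact: partnerP.
    + by move=> u /=; rewrite (partnerE rx).
have T0 x u : ~ T x u.
  by move=> xu; have : [set z : E * E | T z.1 z.2] (x, u) by []; rewrite G0.
have X0 x : ~ X x by move=> /Tdom[u]; exact: T0.
exists (fun _ _ => 1), 1; split => //.
- move=> k; split => //; apply: continuous_subspaceT => x.
  exact: cst_continuous.
- by move=> k x u /T0.
- by move=> x /regularX/X0.
Qed.

(** The first inequality holds for every envelope of phi along T, and the
    second for a late one, since the envelopes tend to phi (partner T x) at
    every regular x. *)
Lemma majorant_integral (phi w : E -> R) (p c : R) : 0 < p -> 1 < c ->
  pos_continuous_on Y phi -> pos_continuous_on Y w ->
  exists2 psi : E -> R, pos_continuous_on X psi &
    (forall x u, T x u -> phi u <= psi x) /\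
    (\int[H]_(x in regular T) (psi x `^ p * w (partner T x))%:E <=
     c%:E * \int[H]_(x in regular T)
       (phi (partner T x) `^ p * w (partner T x))%:E)%E.
Proof.
move=> p0 c1 phiY wY; have [cphi phi0] := phiY; have [cw w0] := wY.
have [f [M [fX fT fM fcvg]]] := envelope_sequence phiY.
have [m1 [M1 [m10 M10 mM1]]] := pos_continuous_bounds cY phiY.
have [m2 [M2 [m20 M20 mM2]]] := pos_continuous_bounds cY wY.
have [|||||||k hk] := @integral_limit_ratio _ B R
  (H : {measure set B -> \bar R}) (regular T)
  (fun k x => f k x `^ p * w (partner T x))
  (fun x => phi (partner T x) `^ p * w (partner T x)) (m1 `^ p * m2)
  (M `^ p * M2) _ _ _ _ _ _ _ c c1.
- exact: measurable_regular.
- move=> k; apply: measurable_funM; last exact: measurable_partner_comp.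
  apply: measurable_regular_fun; exact: (pos_continuous_powR _ (fX k)).1.
- apply: measurable_funM; last exact: measurable_partner_comp.
  exact: (measurable_partner_comp (pos_continuous_powR p phiY).1).
- by rewrite mulr_gt0// powR_gt0.
- move=> x rx; have /andP[h1 _] := mM1 _ (partnerY rx).
  have /andP[h2 _] := mM2 _ (partnerY rx).
  rewrite ler_pM ?powR_ge0//; first exact: ltW.
  by rewrite ge0_ler_powR ?nnegrE// ltW// (lt_le_trans m10).
- move=> k x rx; have /andP[h1 h2] := mM2 _ (partnerY rx).
  have f0 := (fX k).2 _ (regularX rx).
  rewrite mulr_ge0 ?powR_ge0//=; last by rewrite (le_trans _ h1)// ltW.
  rewrite ler_pM ?powR_ge0//; first by rewrite (le_trans _ h1)// ltW.
  rewrite ge0_ler_powR ?nnegrE//; [exact: ltW|exact: ltW| |].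
    by rewrite (le_trans (ltW f0))// fM//; exact: regularX.
  by rewrite fM//; exact: regularX.
- move=> x rx; apply: cvgM; last exact: cvg_cst.
  by apply: cvg_powR; [exact: phi0 (partnerY rx)|exact: fcvg].
by exists (f k) => //; split => // x u; exact: fT.
Qed.

End transfer.

Section limit_ratio.
Variable R : realType.
Local Open Scope ereal_scope.

(** The ratio has to carry the exponent r because in the applications it is
    attached to a factor under this power. *)
Lemma le_of_ratio (r : R) (x y : \bar R) : (0 < r)%R -> 0 <= y ->
  (forall c : R, (1 < c)%R -> x <= c%:E `^ r * y) -> x <= y.
Proof.
move=> r0 y0 H; have [->|yoo] := eqVneq y +oo; first exact: leey.
have yfin : y \is a fin_num by rewrite ge0_fin_numE// lt_neqAle yoo leey.
apply/lee_addgt0Pr => e e0.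
pose d := (e / (1 + fine y))%R.
have y1 : (0 < 1 + fine y)%R by rewrite ltr_pwDl// fine_ge0.
have d0 : (0 < d)%R by rewrite divr_gt0.
have : (1 < (1 + d) `^ r^-1)%R.
  have one : (1 `^ r^-1 = 1 :> R)%R by rewrite powR1.
  rewrite -[ltLHS]one gt0_ltr_powR ?invr_gt0 ?nnegrE//; first lra.
  by rewrite ltrDl.
move=> /H; rewrite poweR_EFin -powRrM mulVf ?gt_eqF// powRr1; last lra.
move=> /le_trans; apply.
rewrite -(fineK yfin) -EFinM -EFinD lee_fin mulrDl mul1r lerD2l.
rewrite /d mulrAC ler_pdivrMr// ler_wpM2l; [by []|exact: ltW|].
by rewrite lerDr.
Qed.

Lemma le_poweR (r : R) (x y : \bar R) : (0 <= r)%R -> 0 <= x -> x <= y ->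
  x `^ r <= y `^ r.
Proof.
move=> r0 x0 xy; apply: gt0_ler_poweR => //; rewrite in_itv/= leey andbT//.
exact: le_trans xy.
Qed.

End limit_ratio.

Lemma swap_continuous (U V : topologicalType) :
  continuous (fun z : U * V => (z.2, z.1)).
Proof.
move=> z; apply: (@cvg_pair _ _ _ _ (nbhs z.2) (nbhs z.1) _ _ _
  (fun z : U * V => z.2) (fun z : U * V => z.1)).
- exact: cvg_snd.
- exact: cvg_fst.
Qed.

Section body_integrals.
Variables (R : realType) (n : nat) (K : set 'rV[R]_n).
Local Notation E := 'rV[R]_n.
Local Notation B := (borelRn R n).
Local Notation H := (@hausdorff R n n.-1).
Hypotheses (hK : convex_body K) (hK0 : K° 0).

(** The transpose of outer normality: the direction comes first. *)
Definition contact (u x : E) := outer_normal K x u.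

Local Notation N := (outer_normal K).
Local Notation S := (sphere R n).

Lemma compact_outer_normal : compact [set z : E * E | N z.1 z.2].
Proof. exact: (compact_normal_bundle hK hK0). Qed.

Lemma compact_contact : compact [set z : E * E | contact z.1 z.2].
Proof.
rewrite [X in compact X](_ : _ = (fun z => (z.2, z.1)) @` normal_bundle K).
  apply: continuous_compact; last exact: compact_normal_bundle.
  by apply: continuous_subspaceT; exact: swap_continuous.
apply/seteqP; split => [[u x] /= ux|_ [[x u] /= xu <-]] //.
by exists (x, u).
Qed.

Lemma outer_normal_dom x u : N x u -> bd K x /\ S u. Proof. by case. Qed.

Lemma contact_dom u x : contact u x -> S u /\ bd K x. Proof. by case. Qed.

Let N0 : H (singular N) = 0%E. Proof. exact: singular_points_null. Qed.

Let C0 : H (singular contact) = 0%E. Proof. exact: singular_normals_null. Qed.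

Let bd0 : ~ bd K 0. Proof. by move=> /bdP []. Qed.

Let S0 : ~ S 0.
Proof.
move=> /sphereE; rewrite -(scale0r (0 : E)) innerZl mul0r => /esym/eqP.
by rewrite oner_eq0.
Qed.

Let mbd : measurable (bd K : set B).
Proof.
apply: closed_measurableRn; apply: compact_closed (@norm_hausdorff _ _) _.
exact: compact_bd.
Qed.

Let mS : measurable (S : set B).
Proof.
apply: closed_measurableRn; apply: compact_closed (@norm_hausdorff _ _) _.
exact: compact_sphere.
Qed.

Lemma continuous_support_fun : continuous (support_fun K).
Proof.
have [M [M0 KM]] : exists M : R, 0 < M /\ forall y, K y -> `|y| <= M.
  have [cK _ _] := hK; have [M [_ bM]] := compact_bounded cK.
  exists (1 + `|M|); split; first by rewrite ltr_pwDl.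
  by move=> y Ky; apply: bM => //; rewrite (le_lt_trans (ler_norm _))// ltrDr.
apply: (@lipschitz_continuous R E _ (n%:R * M)) => [|u v].
  by rewrite mulr_ge0// ltW.
have [x Kx [-> _]] := support_fun_max hK hK0 u.
have -> : inner u x = inner v x + inner (u - v) x by rewrite innerBl; ring.
rewrite lerD ?le_support_fun//; apply: le_trans (ler_norm _) _.
apply: le_trans (inner_le_norm _ _) _.
by rewrite -mulrA ler_wpM2l// mulrC ler_wpM2r// KM.
Qed.

Lemma pos_continuous_support_fun : pos_continuous_on S (support_fun K).
Proof.
split; first by apply: continuous_subspaceT; exact: continuous_support_fun.
by move=> u; exact: support_fun_gt0.
Qed.

Local Open Scope ereal_scope.

Lemma surface_integral (f : E -> R) : pos_continuous_on S f ->
  \int[surface_area_measure K]_(u in S) (f u)%:E =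
  \int[H]_(x in regular N) (f (partner N x))%:E.
Proof.
move=> [cf f0].
apply: (integral_preimage_measure compact_outer_normal N0 mS _ _ S0).
- by apply/measurable_EFinP; apply: within_continuous_measurable => //;
    apply: compact_closed (@norm_hausdorff _ _) _; exact: compact_sphere.
- by move=> u Su; rewrite lee_fin ltW// f0.
- by move=> x u [].
Qed.

Lemma curvature0_integral (f : E -> R) : pos_continuous_on (bd K) f ->
  \int[curvature_measure0 K]_(x in bd K) (f x)%:E =
  \int[H]_(u in regular contact) (f (partner contact u))%:E.
Proof.
move=> [cf f0].
apply: (integral_preimage_measure compact_contact C0 mbd _ _ bd0).
- by apply/measurable_EFinP; apply: within_continuous_measurable => //;
    apply: compact_closed (@norm_hausdorff _ _) _; exact: compact_bd.
- by move=> u Su; rewrite lee_fin ltW// f0.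
- by move=> x u [].
Qed.

Lemma sphere_integral (f : E -> R) : pos_continuous_on S f ->
  \int[H]_(u in S) (f u)%:E = \int[H]_(u in regular contact) (f u)%:E.
Proof.
move=> [cf f0]; apply: (integral_regular compact_contact C0 mS).
- by apply/measurable_EFinP; apply: within_continuous_measurable => //;
    apply: compact_closed (@norm_hausdorff _ _) _; exact: compact_sphere.
- by move=> u Su; rewrite lee_fin ltW// f0.
- by apply/seteqP; split => [u /(exists_contact hK hK0)|u [x []]].
Qed.

Lemma curvature_top_integral (g : E -> R) (p q : R) :
  pos_continuous_on (bd K) g ->
  \int[curvature_measure_top K]_(x in bd K)
    (g x `^ p * support_fun K (gauss_map K x) `^ q)%:E =
  \int[H]_(x in regular N) (g x `^ p * support_fun K (partner N x) `^ q)%:E.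
Proof.
move=> [cg g0].
rewrite (@eq_set_function_integral _ B R (bd K) (curvature_measure_top K) H).
  apply: (integral_regular compact_outer_normal N0 mbd).
  - apply/measurable_EFinP; apply: measurable_funM.
      apply: (measurableT_comp (measurable_powR p)).
      apply: within_continuous_measurable => //.
      by apply: compact_closed (@norm_hausdorff _ _) _; exact: compact_bd.
    apply: (measurableT_comp (measurable_powR q)).
    apply: (@measurableT_comp _ _ _ B B R (support_fun K)).
      have := @within_continuous_measurable R n setT (support_fun K) closedT.
      by apply; apply: continuous_subspaceT; exact: continuous_support_fun.
    apply: measurable_funTS.
    exact: (measurable_partner compact_outer_normal).
  - by move=> x _; rewrite lee_fin mulr_ge0// powR_ge0.
  - by apply/seteqP; split => [u /(exists_normal hK hK0)|u [x []]].
move=> A mA Abd; congr (H _); exact/setIidPr.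
Qed.

End body_integrals.

(** * Comparison of the two infima *)

Section inequalities.
Variables (R : realType) (n : nat) (K : set 'rV[R]_n).
Local Notation E := 'rV[R]_n.
Local Notation B := (borelRn R n).
Local Notation H := (@hausdorff R n n.-1).
Hypotheses (hn : (0 < n)%N) (hK : convex_body K) (hK0 : K° 0).
Local Notation N := (outer_normal K).
Local Notation S := (sphere R n).
Variables (p : R) (hp : 0 < p).

Let w (u : E) := support_fun K u `^ (1 - p).

Let wS : pos_continuous_on S w.
Proof. exact: pos_continuous_powR (pos_continuous_support_fun hK hK0). Qed.

Definition sphere_power_integral (h : E -> R) :=
  (\int[@hausdorff R n n.-1]_(u in sphere R n) (h u ^+ n)%:E)%E.

Definition sphere_weighted_integral (h : E -> R) :=
  (\int[surface_area_measure K]_(u in sphere R n)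
    (h u `^ (- p) * support_fun K u `^ (1 - p))%:E)%E.

Definition boundary_power_integral (g : E -> R) :=
  (\int[curvature_measure0 K]_(x in bd K) (g x ^- n)%:E)%E.

Definition boundary_weighted_integral (g : E -> R) :=
  (\int[curvature_measure_top K]_(x in bd K)
    (g x `^ p * support_fun K (gauss_map K x) `^ (1 - p))%:E)%E.

Lemma pos_continuousM (D : set E) (f g : E -> R) : pos_continuous_on D f ->
  pos_continuous_on D g -> pos_continuous_on D (fun x => f x * g x).
Proof.
move=> [cf f0] [cg g0]; split => [|x Dx]; last by rewrite mulr_gt0 ?f0 ?g0.
by move=> x; apply: cvgM; [exact: cf|exact: cg].
Qed.

Lemma pos_continuousX (D : set E) (f : E -> R) (k : nat) :
  pos_continuous_on D f -> pos_continuous_on D (fun x => f x ^+ k).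
Proof.
move=> fD; have [cf f0] := pos_continuous_powR k%:R fD.
have fE x : D x -> f x ^+ k = f x `^ k%:R.
  by move=> Dx; rewrite powR_mulrn// ltW// fD.2.
split => [|x Dx]; last by rewrite exprn_gt0// fD.2.
apply: (@subspace_eq_continuous _ _ _ (fun x => f x `^ k%:R)) => // x.
by rewrite inE => /fE.
Qed.

Lemma sphere_weighted_integralE h : pos_continuous_on S h ->
  sphere_weighted_integral h =
  (\int[H]_(x in regular N) (h (partner N x) `^ (- p) * w (partner N x))%:E)%E.
Proof.
move=> hS; apply: (surface_integral hK hK0 (f := fun u => h u `^ (- p) * w u)).
exact: pos_continuousM (pos_continuous_powR (- p) hS) wS.
Qed.

Lemma sphere_power_integralE h : pos_continuous_on S h ->
  sphere_power_integral h =
  (\int[H]_(u in regular (contact K)) (h u ^+ n)%:E)%E.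
Proof.
by move=> hS; exact: (sphere_integral hK hK0 (pos_continuousX n hS)).
Qed.

Lemma boundary_power_integralE g : pos_continuous_on (bd K) g ->
  boundary_power_integral g =
  (\int[H]_(u in regular (contact K)) (g (partner (contact K) u) ^- n)%:E)%E.
Proof.
move=> gK; apply: (curvature0_integral hK hK0 (f := fun x => g x ^- n)).
exact: pos_continuousV (pos_continuousX n gK).
Qed.

Lemma boundary_weighted_integralE g : pos_continuous_on (bd K) g ->
  boundary_weighted_integral g =
  (\int[H]_(x in regular N) (g x `^ p * w (partner N x))%:E)%E.
Proof. exact: curvature_top_integral. Qed.

Let N_regular_fun f : pos_continuous_on (bd K) f ->
  measurable_fun (regular N : set B) (f : B -> R).
Proof.
move=> [cf _]; apply: measurable_regular_fun cf.
- exact: outer_normal_dom.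
- exact: compact_bd.
Qed.

Let N_partner_fun f : pos_continuous_on S f ->
  measurable_fun (regular N : set B) (fun x : B => f (partner N x)).
Proof.
move=> [cf _]; apply: measurable_partner_comp cf.
- exact: compact_outer_normal.
- exact: outer_normal_dom.
- exact: compact_sphere.
Qed.

Let C_regular_fun f : pos_continuous_on S f ->
  measurable_fun (regular (contact K) : set B) (f : B -> R).
Proof.
move=> [cf _]; apply: measurable_regular_fun cf.
- exact: contact_dom.
- exact: compact_sphere.
Qed.

Let C_partner_fun f : pos_continuous_on (bd K) f ->
  measurable_fun (regular (contact K) : set B)
    (fun x : B => f (partner (contact K) x)).
Proof.
move=> [cf _]; apply: measurable_partner_comp cf.
- exact: compact_contact.
- exact: contact_dom.
- exact: compact_bd.
Qed.

Let le_regular_integral (D : set B) (f1 f2 : B -> R) : measurable D ->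
  measurable_fun D f1 -> measurable_fun D f2 ->
  (forall x, D x -> 0 <= f1 x <= f2 x) ->
  (\int[H]_(x in D) (f1 x)%:E <= \int[H]_(x in D) (f2 x)%:E)%E.
Proof.
move=> mD m1 m2 f12; apply: ge0_le_integral => //.
- by move=> x /f12/andP[].
- exact/measurable_EFinP.
- exact/measurable_EFinP.
- by move=> x /f12/andP[].
Qed.

(** Take g above 1/h on the normal bundle: at the contact point x of almost
    every direction u this gives g x ^- n <= h u ^+ n, while g x is nearly
    1 / h (partner N x) at the regular points x. *)
Lemma boundary_competitor h (c : R) : pos_continuous_on S h -> 1 < c ->
  exists2 g, pos_continuous_on (bd K) g &
    (boundary_power_integral g <= sphere_power_integral h)%E /\
    (boundary_weighted_integral g <= c%:E * sphere_weighted_integral h)%E.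
Proof.
move=> hS c1; have h0 := hS.2.
have [g gK [hg gE]] := @majorant_integral R n n.-1 N (bd K) S
  (compact_outer_normal hK hK0) (@outer_normal_dom R n K)
  (exists_normal hK hK0) (compact_bd hK) (@compact_sphere R n)
  (fun u => (h u)^-1) w p c hp c1 (pos_continuousV hS) wS.
exists g; [exact: gK|split].
  rewrite (boundary_power_integralE gK) (sphere_power_integralE hS).
  apply: le_regular_integral.
  - by apply: measurable_regular; exact: compact_contact.
  - exact: (C_partner_fun (pos_continuousV (pos_continuousX n gK))).
  - exact: C_regular_fun (pos_continuousX n hS).
  - move=> u ru; have cu := partnerP ru; have [Su bx] := contact_dom cu.
    have g0 := gK.2 _ bx; rewrite invr_ge0 exprn_ge0 ?(ltW g0)//=.
    rewrite -exprVn lerXn2r ?nnegrE ?invr_ge0 ?(ltW g0)//; first exact/ltW/h0.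
    by rewrite -[h u]invrK lef_pV2 ?posrE ?invr_gt0 ?h0//; exact: hg.
rewrite (boundary_weighted_integralE gK) (sphere_weighted_integralE hS).
have powE : (\int[H]_(x in regular N)
      (h (partner N x) `^ (- p) * w (partner N x))%:E =
    \int[H]_(x in regular N)
      ((h (partner N x))^-1 `^ p * w (partner N x))%:E)%E.
  apply: eq_integral => x; rewrite inE => /partnerP/outer_normal_dom[_ Su].
  by rewrite -(powR_inv1 (ltW (h0 _ Su))) -powRrM mulN1r.
by rewrite powE; exact: gE.
Qed.

(** The same argument with the roles of points and directions exchanged: h is
    taken above 1/g on the normal bundle, and now it is the power integral
    that is only nearly preserved. *)
Lemma sphere_competitor g (c : R) : pos_continuous_on (bd K) g -> 1 < c ->
  exists2 h, pos_continuous_on S h &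
    (sphere_power_integral h <= c%:E * boundary_power_integral g)%E /\
    (sphere_weighted_integral h <= boundary_weighted_integral g)%E.
Proof.
move=> gK c1; have g0 := gK.2.
have n0 : 0 < n%:R :> R by rewrite ltr0n.
have one : pos_continuous_on (bd K) (fun=> 1 : R).
  by split=> //; apply: continuous_subspaceT => x; exact: cst_continuous.
have [h hS [gh hE]] := @majorant_integral R n n.-1 (contact K) S (bd K)
  (compact_contact hK hK0) (@contact_dom R n K)
  (exists_contact hK hK0) (@compact_sphere R n) (compact_bd hK)
  (fun x => (g x)^-1) (fun=> 1) n%:R c n0 c1 (pos_continuousV gK) one.
exists h; [exact: hS|split].
  rewrite (sphere_power_integralE hS) (boundary_power_integralE gK).
  have hE' : (\int[H]_(u in regular (contact K)) (h u ^+ n)%:E =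
      \int[H]_(u in regular (contact K)) (h u `^ n%:R * 1)%:E)%E.
    apply: eq_integral => u; rewrite inE => /partnerP/contact_dom[Su _].
    by rewrite mulr1 powR_mulrn// ltW// hS.2.
  have gE : (\int[H]_(u in regular (contact K))
        (g (partner (contact K) u) ^- n)%:E =
      \int[H]_(u in regular (contact K))
        ((g (partner (contact K) u))^-1 `^ n%:R * 1)%:E)%E.
    apply: eq_integral => u; rewrite inE => /partnerP/contact_dom[_ bx].
    by rewrite mulr1 powR_mulrn ?exprVn// invr_ge0 ltW// g0.
  by rewrite hE' gE; exact: hE.
rewrite (sphere_weighted_integralE hS) (boundary_weighted_integralE gK).
apply: le_regular_integral.
- by apply: measurable_regular; exact: compact_outer_normal.
- exact: (N_partner_fun (pos_continuousM (pos_continuous_powR (- p) hS) wS)).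
- apply: measurable_funM; last exact: N_partner_fun.
  exact: N_regular_fun (pos_continuous_powR p gK).
- move=> x rx; have xu := partnerP rx; have [bx Su] := outer_normal_dom xu.
  have h0 := hS.2 _ Su; rewrite mulr_ge0 ?powR_ge0//=.
  rewrite ler_wpM2r ?powR_ge0// powRN -[g x `^ p]invrK.
  rewrite lef_pV2 ?posrE ?invr_gt0 ?powR_gt0 ?g0// -powR_inv1 ?powR_ge0//.
  rewrite -powRrM mulrC powRrM powR_inv1 ?(ltW (g0 _ bx))//.
  rewrite ge0_ler_powR ?nnegrE ?invr_ge0 ?(ltW (g0 _ bx)) ?(ltW h0) ?(ltW hp)//.
  exact: gh.
Qed.

Lemma infima_eq :
  ereal_inf [set (sphere_power_integral h `^ (p / (n%:R + p)) *
    sphere_weighted_integral h `^ (n%:R / (n%:R + p)))%E |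
    h in pos_continuous_on S] =
  ereal_inf [set (boundary_power_integral g `^ (p / (n%:R + p)) *
    boundary_weighted_integral g `^ (n%:R / (n%:R + p)))%E |
    g in pos_continuous_on (bd K)].
Proof.
have n0 : 0 < n%:R :> R by rewrite ltr0n.
have np : 0 < n%:R + p by rewrite addr_gt0.
have s0 : 0 < p / (n%:R + p) by rewrite divr_gt0.
have t0 : 0 < n%:R / (n%:R + p) by rewrite divr_gt0.
move: (p / _) (n%:R / _) s0 t0 => s t s0 t0.
have spi_ge0 h : pos_continuous_on S h -> (0 <= sphere_power_integral h)%E.
  move=> hS; apply: integral_ge0 => u Su.
  by rewrite lee_fin exprn_ge0// ltW// hS.2.
have swi_ge0 h : pos_continuous_on S h -> (0 <= sphere_weighted_integral h)%E.
  move=> hS; rewrite (sphere_weighted_integralE hS).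
  apply: integral_ge0 => x rx.
  by rewrite lee_fin; apply: mulr_ge0; exact: powR_ge0.
have bpi_ge0 g : pos_continuous_on (bd K) g ->
    (0 <= boundary_power_integral g)%E.
  move=> gK; rewrite (boundary_power_integralE gK); apply: integral_ge0 => u ru.
  have [_ bx] := contact_dom (partnerP ru).
  by rewrite lee_fin invr_ge0 exprn_ge0// ltW// gK.2.
have bwi_ge0 g : pos_continuous_on (bd K) g ->
    (0 <= boundary_weighted_integral g)%E.
  move=> gK; rewrite (boundary_weighted_integralE gK).
  apply: integral_ge0 => x rx.
  by rewrite lee_fin; apply: mulr_ge0; exact: powR_ge0.
apply/eqP; rewrite eq_le; apply/andP; split; apply: le_ereal_inf_tmp.
- move=> _ [g gK <-]; apply: (le_of_ratio s0).
    by apply: mule_ge0; exact: poweR_ge0.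
  move=> c c1; have [h hS [hv he]] := sphere_competitor gK c1.
  have c0 : (0 <= c%:E)%E by rewrite lee_fin ltW// (lt_trans ltr01).
  rewrite muleA -(poweRM s c0 (bpi_ge0 _ gK)).
  apply: (le_trans (ereal_inf_lbound _)); first by exists h; [exact: hS|].
  apply: lee_pmul; [exact: poweR_ge0|exact: poweR_ge0| |].
  + exact: le_poweR (ltW s0) (spi_ge0 _ hS) hv.
  + exact: le_poweR (ltW t0) (swi_ge0 _ hS) he.
- move=> _ [h hS <-]; apply: (le_of_ratio t0).
    by apply: mule_ge0; exact: poweR_ge0.
  move=> c c1; have [g gK [gv ge]] := boundary_competitor hS c1.
  have c0 : (0 <= c%:E)%E by rewrite lee_fin ltW// (lt_trans ltr01).
  rewrite muleCA -(poweRM t c0 (swi_ge0 _ hS)).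
  apply: (le_trans (ereal_inf_lbound _)); first by exists g; [exact: gK|].
  apply: lee_pmul; [exact: poweR_ge0|exact: poweR_ge0| |].
  + exact: le_poweR (ltW s0) (bpi_ge0 _ gK) gv.
  + exact: le_poweR (ltW t0) (bwi_ge0 _ gK) ge.
Qed.
End inequalities.

Theorem theorem6p3 (R : realType) (n : nat) (hn : (0 < n)%N) (p : R)
    (hp : 0 < p) (K : set 'rV[R]_n) (hK : convex_body K)
    (hK0 : interior K 0) :
  ereal_inf
    [set ((\int[@hausdorff R n n.-1]_(u in sphere R n) (h u ^+ n)%:E)
            `^ (p / (n%:R + p)) *
          (\int[surface_area_measure K]_(u in sphere R n)
              (h u `^ (- p) * support_fun K u `^ (1 - p))%:E)
            `^ (n%:R / (n%:R + p)))%E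
    | h in pos_continuous_on (sphere R n)]
  =
  ereal_inf
    [set ((\int[curvature_measure0 K]_(x in bd K) (g x ^- n)%:E)
            `^ (p / (n%:R + p)) *
          (\int[curvature_measure_top K]_(x in bd K)
              (g x `^ p * support_fun K (gauss_map K x) `^ (1 - p))%:E)
            `^ (n%:R / (n%:R + p)))%E
    | g in pos_continuous_on (bd K)].
Proof. exact: infima_eq. Qed.
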